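(* Let $C\in M_d(\mathbb{R})$ be completely positive and let $\mu\in\mathbb{R}^d$ have only strictly positive entries. Then there exists a $d$-dimensional multivariate subordinator $L$ such that $E(L_1)=\mu$ and $\mathrm{var}(L_1)=C$.
   Context: $M_d(\mathbb{R})$ is the set of real $d\times d$ matrices and $M_{d,k}(\mathbb{R})$ the set of real $d\times k$ matrices. A $d$-dimensional multivariate subordinator is a $d$-dimensional Lévy process all of whose components are univariate Lévy subordinators (i.e. non-decreasing real Lévy processes; deterministic drifts are allowed). $\mathrm{var}(L_1)$ is the $d\times d$ covariance matrix of $L_1$. A matrix $C\in M_d(\mathbb{R})$ is called completely positive if there exist $k\in\mathbb{N}$ and $B\in M_{d,k}(\mathbb{R})$ with all entries non-negative such that $C=BB^{\mathrm{T}}$. *)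

(* Defs.v *)
From HB Require Import structures.
From mathcomp Require Import all_boot all_order all_algebra.
From mathcomp Require Import all_classical all_reals all_analysis.
Set Implicit Arguments.
Unset Strict Implicit.
Unset Printing Implicit Defensive.
Import Order.TTheory GRing.Theory Num.Theory.
Import numFieldNormedType.Exports.
Local Open Scope classical_set_scope.
Local Open Scope ring_scope.

Definition completely_positive (R : realType) (d : nat) (C : 'M[R]_d) : Prop :=
  exists (k : nat) (B : 'M[R]_(d, k)),
    (forall i j, 0 <= B i j) /\ C = B *m B^T.

(* The library gives 'rV[R]_d a topology but no measurable structure. *)
Definition borel_rV (R : realType) (d : nat) : set (set 'rV[R]_d) :=
  <<s [set A : set 'rV[R]_d | open A] >>.

Section processes.
Context (R : realType) (disp : measure_display) (Omega : measurableType disp).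
Variable P : probability Omega R.

Definition random_vector (d : nat) (X : Omega -> 'rV[R]_d) : Prop :=
  forall A, borel_rV A -> measurable (X @^-1` A).

(* Taking A i = setT outside a subfamily yields the product rule for it. *)
Definition mutually_independent (d n : nat)
    (X : 'I_n -> Omega -> 'rV[R]_d) : Prop :=
  forall A : 'I_n -> set 'rV[R]_d, (forall i, borel_rV (A i)) ->
    P [set w | forall i, A i (X i w)] =
    (\prod_(i < n) P (X i @^-1` A i))%E.

(* Processes are indexed by all of R, but only times t >= 0 are constrained. *)
Record levy_process (d : nat) (L : R -> Omega -> 'rV[R]_d) : Prop := {
  levy_random_vector : forall t, 0 <= t -> random_vector (L t) ;
  levy_start : {ae P, forall w, L 0 w = 0} ;
  levy_independent_increments : forall (n : nat) (t : nat -> R),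
    0 <= t 0%N -> (forall i, (i < n)%N -> t i < t i.+1) ->
    mutually_independent (fun (i : 'I_n) w => L (t i.+1) w - L (t i) w) ;
  levy_stationary_increments : forall (s h : R), 0 <= s -> 0 <= h ->
    forall A, borel_rV A ->
      P [set w | A (L (s + h) w - L s w)] = P [set w | A (L h w - L 0 w)] ;
  levy_stochastic_continuity : forall (t e : R), 0 <= t -> 0 < e ->
    P [set w | e < `|L s w - L t w|]
      @[s --> within [set s | 0 <= s] (nbhs t)] --> 0%E ;
  levy_cadlag : {ae P, forall w, forall t : R, 0 <= t ->
    L s w @[s --> t^'+] --> L t w /\
    (0 < t -> cvg (L s w @[s --> t^'-]))} }.

Definition subordinator (X : R -> Omega -> R) : Prop :=
  levy_process (fun t w => const_mx (X t w) : 'rV[R]_1) /\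
  {ae P, forall w, forall s t : R, 0 <= s -> s <= t -> X s w <= X t w}.

Definition multivariate_subordinator (d : nat)
    (L : R -> Omega -> 'rV[R]_d) : Prop :=
  levy_process L /\ forall i, subordinator (fun t w => L t w ord0 i).

(* A measurable function whose library integral is finite is integrable
   (+oo - +oo is -oo), so the two predicates below include the existence of
   the moments they mention. *)
Definition has_mean (d : nat) (X : Omega -> 'rV[R]_d) (mu : 'rV[R]_d) : Prop :=
  forall i, 'E_P[fun w => X w ord0 i]%E = (mu ord0 i)%:E.

Definition has_covariance_matrix (d : nat) (X : Omega -> 'rV[R]_d)
    (C : 'M[R]_d) : Prop :=
  forall i j, covariance P (fun w => X w ord0 i) (fun w => X w ord0 j) =
    (C i j)%:E.

End processes.

(* Main.v *)
Require Import Defs.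
From HB Require Import structures.
From mathcomp Require Import all_boot all_order all_algebra.
From mathcomp Require Import all_classical all_reals all_analysis.
From mathcomp Require Import measurable_realfun ring lra zify.
Set Implicit Arguments.
Unset Strict Implicit.
Unset Printing Implicit Defensive.
Import Order.TTheory GRing.Theory Num.Theory.
Import numFieldNormedType.Exports.
Local Open Scope classical_set_scope.
Local Open Scope ring_scope.

(** Write C = B B^T with B nonnegative of size d x k, and let N be a vector of
    k independent Poisson processes of rate a^-2.  The process
      L_t = gam t + a B N_t
    is a Levy process; its covariance matrix at time 1 is
    a^2 a^-2 B B^T = C whatever a is, while its mean is gam + a^-1 B 1.  The
    jumps therefore contribute arbitrarily little to the mean when a is
    large, and as mu is strictly positive, a can be chosen so that the drift
    gam = mu - a^-1 B 1 is nonnegative.  All coordinates of L are then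
    nondecreasing, and each is itself a process of the same form with d = 1.

    The bulk of the work is the construction of N.  The probability space is
    that of a sequence of fair coins, the image of Lebesgue measure on ]0, 1]
    under binary expansion.  Reading the coins of even and of odd rank splits
    a point of this space into two independent points with the same law
    (coin_measure_split), and reading all coins as binary digits yields a
    uniform variable (coin_measure_dyadic_value); iterating the splitting
    provides all the independent uniform variables that are needed.

    Each unit of time receives a Poisson number of independent uniform
    points.  A point carries both a type and a time inside its unit,
    according to the cell of ]0, 1] it falls in and to its position there.
    The counts of points in disjoint classes are independent Poisson
    variables: for one unit this is the multinomial formula
    (P_class_counts) mixed over a Poisson total (P_unit_counts), and the
    units add up because Poisson masses convolve (P_total_classes).
    Windows of the form type x time interval are such classes, which is the
    joint law of the increments of N (P_typed_increments).

    The increments of N live in the countable set nat^k, so mutual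
    independence and equality in law of the increments of L for Borel sets
    reduce to identities between point masses (discrete_independence,
    eq_P_discrete). *)

(** * Fair coins *)

Definition coin_box (S : nat -> pred bool) : set (nat -> bool) :=
  [set w | forall i, S i (w i)].

(** Boxes constrain finitely many coins, each by an arbitrary predicate; unlike
    cylinders that fix a prefix, they are stable under intersection and their
    pullbacks along [evens] and [odds] are boxes again. *)
Definition coin_boxes : set (set (nat -> bool)) :=
  [set coin_box S | S in
    [set S | exists n, forall i, (n <= i)%N -> S i = xpredT]].

Notation coin_space := (g_sigma_algebraType coin_boxes).

Definition evens (w : coin_space) : coin_space := fun i => w i.*2.
Definition odds (w : coin_space) : coin_space := fun i => w i.*2.+1.

Section fair_coins.
Context (R : realType).

(** The doubling map of the circle, on representatives in ]0, 1]. *)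
Definition doubling (x : R) : R := 2 * x - (2^-1 < x)%R%:R.

(** The strict comparison selects the binary expansion with infinitely many
    ones, which matches the half-open interval ]0, 1]. *)
Definition digits (x : R) : coin_space := fun i => (2^-1 < iter i doubling x)%R.

Lemma measurable_bool_natr d (T : measurableType d) (f : T -> bool) :
  measurable_fun setT f -> measurable_fun setT (fun x => (f x)%:R : R).
Proof.
by move=> mf; apply: (measurableT_comp (f := fun b : bool => b%:R : R) (g := f)).
Qed.

Lemma measurable_doubling : measurable_fun setT doubling.
Proof.
apply: measurable_funB; first exact: measurable_funM.
exact/measurable_bool_natr/measurable_fun_ltr.
Qed.

Lemma measurable_iter_doubling i : measurable_fun setT (iter i doubling).
Proof.
elim: i => [|i IH] /=; first exact: measurable_id.
exact: (measurableT_comp measurable_doubling IH).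
Qed.

Lemma measurable_digit i : measurable_fun setT (digits ^~ i).
Proof.
apply: measurable_fun_ltr; first exact: measurable_cst.
exact: measurable_iter_doubling.
Qed.

Lemma measurable_box d (T : measurableType d) (f : T -> nat -> bool) S :
  (forall i, measurable_fun setT (f ^~ i)) -> measurable (f @^-1` coin_box S).
Proof.
move=> mf; rewrite (_ : _ @^-1` _ = \bigcap_i ((f ^~ i) @^-1` [set b | S i b])).
  apply: bigcapT_measurable => i; rewrite -[X in measurable X]setTI.
  exact: mf.
by apply/seteqP; split => [w /= H i _|w H i] /=; [exact: H | exact: (H i)].
Qed.

Lemma measurable_to_coins d (T : measurableType d) (f : T -> coin_space) :
  (forall i, measurable_fun setT (f ^~ i)) -> measurable_fun setT f.
Proof.
move=> mf; apply: (@measurability _ _ T coin_space setT f coin_boxes erefl).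
by move=> _ [_ [S _ <-] <-]; rewrite setTI; exact: measurable_box.
Qed.

Lemma measurable_coin i : measurable_fun setT (fun w : coin_space => w i).
Proof.
apply: (measurable_fun_bool true); rewrite setTI; apply: sub_sigma_algebra.
exists (fun j b => (j == i) ==> b).
  by exists i.+1 => j ij; apply/funext => b; rewrite gtn_eqF.
apply/seteqP; split => [w /(_ i)|w /= wi j]; first by rewrite eqxx /= => ->.
by apply/implyP => /eqP ->.
Qed.

Lemma measurable_evens : measurable_fun setT evens.
Proof. by apply: measurable_to_coins => i; exact: measurable_coin. Qed.

Lemma measurable_odds : measurable_fun setT odds.
Proof. by apply: measurable_to_coins => i; exact: measurable_coin. Qed.

Lemma measurable_digits : measurable_fun setT digits.
Proof. by apply: measurable_to_coins => i; exact: measurable_digit. Qed.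

Local Notation leb := (@lebesgue_measure R).

Let unit_itv_measurable :
  measurable (`]0, 1]%classic : set (measurableTypeR R)).
Proof. exact: measurable_itv. Qed.

Let unif : {measure set (measurableTypeR R) -> \bar R} :=
  mrestr leb unit_itv_measurable.

Let unif_itv (a b : R) : 0 <= a -> b <= 1 -> a <= b ->
  unif `]a, b]%classic = (b - a)%:E.
Proof.
move=> a0 b1 ab; rewrite /unif /= /mrestr setIidl; last first.
  move=> x /=; rewrite !in_itv /= => /andP[ax xb].
  by rewrite (le_lt_trans a0 ax) (le_trans xb b1).
rewrite lebesgue_measure_itv /= lte_fin -EFinB; case: ltgtP ab => // -> _.
by rewrite subrr.
Qed.

Let unif_eq A B : A `&` `]0, 1] = B `&` `]0, 1] -> unif A = unif B.
Proof. by rewrite /unif /= /mrestr => ->. Qed.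


Let half : {nonneg R} := NngNum (ltac:(rewrite invr_ge0 //) : 0 <= 2^-1 :> R).

(** Each branch of the doubling map is affine of slope 2 and maps a half of
    ]0, 1] onto ]0, 1].  This is what makes the first digit a fair coin
    independent of the remaining ones. *)
Lemma unif_doubling (b : bool) (A : set R) : measurable A ->
  unif ([set x | (2^-1 < x) = b] `&` doubling @^-1` A) = (2^-1%:E * unif A)%E.
Proof.
move=> mA.
have mb : measurable [set x : measurableTypeR R | (2^-1 < x) = b].
  rewrite (_ : [set _ | _] = setT `&` (fun x => 2^-1 < x) @^-1` [set b]).
    have mf : measurable_fun setT (fun x : R => 2^-1 < x).
      exact: measurable_fun_ltr.
    exact: mf.
  by rewrite setTI.
pose m2 : {measure set (measurableTypeR R) -> \bar R} := mscale half unif.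
pose m0 : {measure set (measurableTypeR R) -> \bar R} := mrestr unif mb.
pose m1 : {measure set (measurableTypeR R) -> \bar R} :=
  @pushforward _ _ (measurableTypeR R) (measurableTypeR R) R m0 doubling.
suff E : m1 measurable_doubling A = m2 A by rewrite setIC; exact: E.
apply: (@measure_unique _ R (measurableTypeR R) (@RGenOInfty.G R)
  (fun n => `]- n%:R, +oo[%classic) _ _ _ _
  (m1 measurable_doubling) m2 _ _ A mA) => //.
- exact: RGenOInfty.measurableE.
- move=> _ _ [x ->] [y ->]; exists (Num.max x y).
  by apply/seteqP; split => z /=; rewrite !in_itv /= !andbT gt_max => /andP.
- by move=> i; exists (- i%:R).
- apply/seteqP; split => // x _; exists (Num.truncn `|x|).+1 => //=.
  rewrite in_itv /= andbT ltrNl (le_lt_trans (ler_norm _))// normrN.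
  exact: truncnS_gt.
- move=> _ [x ->]; 
  suff : unif (doubling @^-1` `]x, +oo[ `&` [set z | (2^-1 < z) = b]) =
    (2^-1%:E * unif `]x, +oo[%classic)%E by [].
  (* y is x truncated to [0, 1]. *)
  have [y [y0 y1 xy]] : exists y : R, [/\ 0 <= y, y <= 1 &
      forall z, 0 < z -> z <= 1 -> (x < z) = (y < z)].
    exists (Num.max 0 (Num.min x 1)); split.
    - by rewrite le_max lexx.
    - by rewrite ge_max ler01 ge_min lexx orbT.
    - by move=> z z0 z1; rewrite gt_max z0 gt_min (ltNge 1) z1 /= orbF.
  rewrite (@unif_eq `]x, +oo[%classic `]y, 1]%classic) ?unif_itv //; last first.
    apply/seteqP; split => z /=; rewrite !in_itv /= andbT => -[xz /andP[z0 z1]].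
      by rewrite z0 z1 -xy// xz.
    by move: xz => /andP[yz _]; rewrite z0 z1 xy.
  have [c [c0 c1 E]] : exists c : R, [/\ 0 <= c, c + (1 - y) / 2 <= 1 &
    doubling @^-1` `]x, +oo[ `&` [set z | (2^-1 < z) = b] `&` `]0, 1] =
    `]c, c + (1 - y) / 2] `&` `]0, 1]].
    exists (if b then (y + 1) / 2 else y / 2).
    split; [case: b {mb m0 m1}; lra | case: b {mb m0 m1}; lra |].
    apply/seteqP; split => z /=; rewrite !in_itv /= !andbT /doubling.
      move=> [[xz <-] /andP[z0 z1]]; move: xz.
      by case: (ltP 2^-1 z) => z2 /=; rewrite xy; lra.
    move=> [cz /andP[z0 z1]].
    have -> : (2^-1 < z) = b.
      by case: b {mb m0 m1} cz => /andP[? ?]; 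
        [rewrite -[_ = true]/(is_true _); lra|apply/negbTE; rewrite -leNgt; lra].
    by rewrite z0 z1 xy; case: b {mb m0 m1} cz => /andP[/= ? ?];
      (do ?split) => //; lra.
  rewrite (unif_eq E) unif_itv //; last by lra.
  by rewrite -EFinM; congr EFin; field.
- move=> k; apply: (@le_lt_trans _ _ (leb `]0, 1])); last first.
    by rewrite lebesgue_measure_itv /= lte_fin ltr01 ltry.
  apply: le_measure; rewrite ?inE //.
  apply: measurableI => //; apply: measurableI => //.
  by rewrite -[X in measurable X]setTI; exact: measurable_doubling.
Qed.

Lemma digitsS x i : digits x i.+1 = digits (doubling x) i.
Proof. by rewrite /digits iterSr. Qed.

Definition coin_weight (s : pred bool) : R := ((s true + s false)%N)%:R / 2.

Lemma unif_box n (S : nat -> pred bool) :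
  unif [set x | forall i, (i < n)%N -> S i (digits x i)] =
  (\prod_(i < n) coin_weight (S i))%:E.
Proof.
elim: n S => [|n IH] S.
  rewrite big_ord0 (_ : [set _ | _] = setT); last by apply/seteqP; split.
  by rewrite (@unif_eq setT `]0, 1]%classic) ?unif_itv ?setTI ?setIid // subr0.
pose A := [set x : R | forall i, (i < n)%N -> S i.+1 (digits x i)].
have mA : measurable A.
  rewrite /A (_ : [set _ | _] = digits @^-1`
      coin_box (fun i b => (i < n)%N ==> S i.+1 b)).
    by apply: measurable_box => i; exact: measurable_digit.
  by apply/seteqP; split => x /= H i; [apply/implyP/H | apply/implyP/H].
pose B b := [set x : R | (2^-1 < x) = b] `&` doubling @^-1` A.
have mB b : measurable (B b).
  apply: measurableI.
    have mf : measurable_fun setT (fun x : R => 2^-1 < x).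
      exact: measurable_fun_ltr.
    by have := mf measurableT [set b] I; rewrite setTI.
  by have := measurable_doubling measurableT mA; rewrite setTI.
rewrite (_ : [set _ | _] = (if S 0%N true then B true else set0) `|`
                           (if S 0%N false then B false else set0)); last first.
  apply/seteqP; split => x /=.
    move=> H; have := H 0%N isT; rewrite /digits /=.
    have xA : A (doubling x) by move=> i ni; rewrite -digitsS; exact: H.
    by case E : (2^-1 < x) => ->; [left|right].
  have H b : S 0%N b -> B b x -> forall i, (i < n.+1)%N -> S i (digits x i).
    move=> + [Eb xA]; move: Eb => /= <- S0 [//|i ni].
    by rewrite digitsS; exact: xA.
  by case: ifP => St [|]//; [exact: H| |]; case: ifP => // Sf; exact: H.
rewrite measureU.
- rewrite big_ord_recl EFinM -[X in (_ * X)%E](IH (fun i => S i.+1)) -/A.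
  have U b : unif (if S 0%N b then B b else set0) =
    (((S 0%N b)%:R / 2)%:E * unif A)%E.
    case: (S 0%N b); first by rewrite unif_doubling // mul1r.
    by rewrite measure0 mul0r mul0e.
  transitivity (((S 0%N true)%:R / 2)%:E * unif A +
                ((S 0%N false)%:R / 2)%:E * unif A)%E.
    by congr (_ + _)%E; exact: U.
  rewrite -ge0_muleDl ?lee_fin ?divr_ge0 //.
  by rewrite -EFinD -mulrDl -natrD.
- by case: ifP => _; [exact: mB | exact: measurable0].
- by case: ifP => _; [exact: mB | exact: measurable0].
- apply/seteqP; split => // x /= [].
  by case: ifP => // _ [+ _]; case: ifP => // _ + [+ _] => /= ->.
Qed.

Definition coin_measure : set coin_space -> \bar R :=
  @pushforward _ _ (measurableTypeR R) coin_space R unif digits.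

Let coin_measure0 : coin_measure set0 = 0%E.
Proof. by rewrite /coin_measure /pushforward preimage_set0 measure0. Qed.

Let coin_measure_ge0 A : (0 <= coin_measure A)%E.
Proof. exact: (measure_ge0 unif). Qed.

Let coin_measure_sigma_additive : semi_sigma_additive coin_measure.
Proof.
pose m : {measure set coin_space -> \bar R} :=
  @pushforward _ _ (measurableTypeR R) coin_space R unif digits.
exact: (@measure_semi_sigma_additive _ _ _ (m measurable_digits)).
Qed.

HB.instance Definition _ := isMeasure.Build _ _ _ coin_measure
  coin_measure0 coin_measure_ge0 coin_measure_sigma_additive.

Let coin_measure_setT : coin_measure setT = 1%E.
Proof.
rewrite /coin_measure /pushforward preimage_setT.
by rewrite (@unif_eq setT `]0, 1]%classic) ?unif_itv ?setTI ?setIid // subr0.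
Qed.

HB.instance Definition _ :=
  @Measure_isProbability.Build _ _ R coin_measure coin_measure_setT.

Lemma coin_measure_box n (S : nat -> pred bool) :
  (forall i, (n <= i)%N -> S i = xpredT) ->
  coin_measure (coin_box S) = (\prod_(i < n) coin_weight (S i))%:E.
Proof.
move=> hS; rewrite -unif_box /coin_measure /pushforward; congr (unif _).
apply/seteqP; split => x /= H i; first by move=> _; exact: H.
by case: (ltnP i n) => [/H//|/hS ->].
Qed.

Lemma setI_closed_coin_boxes : setI_closed coin_boxes.
Proof.
move=> _ _ [S [n hn] <-] [S' [m hm] <-].
exists (fun i b => S i b && S' i b).
  exists (maxn n m) => i; rewrite geq_max => /andP[/hn -> /hm ->].
  exact/funext.
apply/seteqP; split => w /=; last by move=> [Sw S'w] i; rewrite Sw S'w.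
by move=> H; split => i; have /andP[] := H i.
Qed.

Lemma coin_boxesT : coin_boxes [set: coin_space].
Proof. by exists (fun=> xpredT); [exists 0%N | apply/seteqP; split]. Qed.

Lemma coin_measure_unique (m1 m2 : {measure set coin_space -> \bar R}) :
  (forall S, coin_boxes S -> m1 S = m2 S) -> (m1 setT < +oo)%E ->
  forall A, measurable A -> m1 A = m2 A.
Proof.
move=> m12 m1T; apply: (@measure_unique _ R coin_space coin_boxes (fun=> setT)) => //.
- exact: setI_closed_coin_boxes.
- by move=> _; exact: coin_boxesT.
- by rewrite bigcup_const.
Qed.

Lemma coin_measure_split_box (S S' : set coin_space) :
  coin_boxes S -> coin_boxes S' ->
  coin_measure (evens @^-1` S `&` odds @^-1` S') =
  (coin_measure S * coin_measure S')%E.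
Proof.
move=> [T [n0 hn] <-] [T' [m0 hm] <-].
pose n := maxn n0 m0.
have {}hn i : (n <= i)%N -> T i = xpredT.
  by move=> ni; apply: hn; apply: leq_trans ni; exact: leq_maxl.
have {}hm i : (n <= i)%N -> T' i = xpredT.
  by move=> ni; apply: hm; apply: leq_trans ni; exact: leq_maxr.
pose V i := if odd i then T' i./2 else T i./2.
have -> : evens @^-1` coin_box T `&` odds @^-1` coin_box T' = coin_box V.
  apply/seteqP; split => w /=.
    move=> [H H'] i; rewrite /V -[X in w X]odd_double_half.
    by case: (odd i); [exact: H' | exact: H].
  move=> H; split => i; have := H i.*2; have := H i.*2.+1;
    by rewrite /V /evens /odds /= odd_double /= ?uphalf_double ?doubleK.
rewrite (@coin_measure_box n.*2) ?(@coin_measure_box n) //; last first.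
  by move=> i ni; rewrite /V; case: ifP => _; [apply: hm | apply: hn]; lia.
rewrite -EFinM; congr EFin; rewrite -big_split /=.
elim: {hn hm} n => [|n IH]; first by rewrite !big_ord0.
rewrite doubleS 2!big_ord_recr [RHS]big_ord_recr /= IH -mulrA.
by rewrite /V /= odd_double /= uphalf_double doubleK.
Qed.

(** Boxes are a generating pi-system, so the product formula extends from boxes
    to measurable sets in one variable at a time. *)
Lemma coin_measure_split (A B : set coin_space) :
  measurable A -> measurable B ->
  coin_measure (evens @^-1` A `&` odds @^-1` B) =
  (coin_measure A * coin_measure B)%E.
Proof.
have mpre (f : coin_space -> coin_space) D : measurable_fun setT f ->
    measurable D -> measurable (f @^-1` D).
  by move=> mf mD; rewrite -[X in measurable X]setTI; exact: mf.
have finD D : measurable D -> coin_measure D = (fine (coin_measure D))%:E.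
  by move=> mD; rewrite fineK // fin_num_measure.
have nng D : 0 <= fine (coin_measure D) by rewrite fine_ge0.
have mbox D : coin_boxes D -> measurable (D : set coin_space).
  exact: sub_sigma_algebra.
have finT : (coin_measure setT < +oo)%E by rewrite coin_measure_setT ltry.
have slice f (mf : measurable_fun setT (f : coin_space -> coin_space))
    (D : set coin_space) (mD : measurable D) (C : set coin_space) :
    (forall S, coin_boxes S -> coin_measure (f @^-1` S `&` D) =
       (coin_measure S * coin_measure D)%E) ->
    measurable C ->
    coin_measure (f @^-1` C `&` D) = (coin_measure C * coin_measure D)%E.
  move=> H mC.
  pose m0 : {measure set coin_space -> \bar R} := mrestr coin_measure mD.
  pose m1 : {measure set coin_space -> \bar R} :=
    @pushforward _ _ coin_space coin_space R m0 f.
  pose m2 : {measure set coin_space -> \bar R} :=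
    mscale (NngNum (nng D)) coin_measure.
  have -> : (coin_measure C * coin_measure D)%E = m2 C.
    by rewrite muleC [X in (X * _)%E]finD.
  apply: (@coin_measure_unique (m1 mf) m2) => //.
  - move=> S hS; transitivity (coin_measure (f @^-1` S `&` D)) => //.
    by rewrite H // muleC [X in (X * _)%E]finD.
  - by apply: le_lt_trans finT; apply: le_measure; rewrite ?inE //;
      apply: measurableI => //; exact: mpre.
move=> mA mB.
have PT : coin_measure setT = 1%E by exact: coin_measure_setT.
have mulT (x : \bar R) : (x * coin_measure setT)%E = x.
  by rewrite -[RHS]mule1; congr (_ * _)%E; exact: PT.
have Pev S : coin_boxes S -> coin_measure (evens @^-1` S) = coin_measure S.
  move=> hS; have := coin_measure_split_box hS coin_boxesT.
  by rewrite preimage_setT setIT => ->; exact: mulT.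
have Pod : coin_measure (odds @^-1` B) = coin_measure B.
  transitivity (coin_measure (odds @^-1` B `&` setT)); first by rewrite setIT.
  rewrite -[RHS]mulT; apply: (slice) => //; first exact: measurable_odds.
  move=> S hS; have := coin_measure_split_box coin_boxesT hS.
  rewrite preimage_setT setTI setIT => ->; rewrite muleC.
  by congr (_ * _)%E.
rewrite -Pod; apply: (slice) => //; [exact: measurable_evens| |].
  by apply: mpre => //; exact: measurable_odds.
move=> S hS; rewrite setIC Pod muleC -(Pev _ hS); apply: (slice) => //.
- exact: measurable_odds.
- by apply: mpre; [exact: measurable_evens | exact: mbox].
- by move=> S' hS'; rewrite setIC coin_measure_split_box // Pev // muleC.
Qed.

(** * Uniform variables *)
Definition dyadic_partial (n : nat) (w : coin_space) : R :=
  \sum_(i < n) (w i)%:R / 2 ^+ i.+1.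

Definition dyadic_value (w : coin_space) : R := limn (dyadic_partial ^~ w).

Lemma nondecreasing_dyadic_partial w :
  nondecreasing_seq (dyadic_partial ^~ w).
Proof.
apply/nondecreasing_seqP => n; rewrite /dyadic_partial big_ord_recr /=.
by rewrite lerDl divr_ge0 // exprn_ge0.
Qed.

Lemma dyadic_partial_le1 n w : dyadic_partial n w <= 1.
Proof.
suff : dyadic_partial n w <= 1 - 2 ^- n.
  by move/le_trans; apply; rewrite lerBlDr lerDl invr_ge0 exprn_ge0.
rewrite /dyadic_partial; elim: n => [|n IH].
  by rewrite big_ord0 expr0 invr1 subrr.
rewrite big_ord_recr /=; apply: (le_trans (lerD IH (_ : _ <= 2 ^- n.+1))).
  by rewrite ler_piMl ?invr_ge0 ?exprn_ge0 //; case: (w n).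
have n0 : (2 : R) ^+ n != 0 by rewrite expf_neq0.
by rewrite exprS invfM; lra.
Qed.

Lemma cvg_dyadic_partial w : cvgn (dyadic_partial ^~ w).
Proof.
apply: nondecreasing_is_cvgn; first exact: nondecreasing_dyadic_partial.
by exists 1 => _ [n _ <-]; exact: dyadic_partial_le1.
Qed.

Lemma measurable_dyadic_value : measurable_fun setT dyadic_value.
Proof.
apply: (measurable_fun_cvg (h := dyadic_partial)) => [n|w _]; last first.
  exact: cvg_dyadic_partial.
apply: measurable_sum => i; apply: measurable_funM => //.
by apply: measurable_bool_natr; exact: measurable_coin.
Qed.

Lemma dyadic_value_digits x : 0 < x <= 1 -> dyadic_value (digits x) = x.
Proof.
move=> x01; have Dx n : 0 < iter n doubling x <= 1 /\
    dyadic_partial n (digits x) = x - iter n doubling x / 2 ^+ n.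
  elim: n => [|n [IH1 IH2]].
    by rewrite /dyadic_partial big_ord0 /= expr0 divr1 subrr.
  rewrite /dyadic_partial big_ord_recr /= -/(dyadic_partial n _) IH2 /digits.
  move: (iter n doubling x) IH1 => y /andP[y0 y1]; rewrite /doubling.
  split; first by case: (ltP 2^-1 y) => ? /=; apply/andP; split; lra.
  have n0 : (2 : R) ^+ n != 0 by rewrite expf_neq0.
  by rewrite exprS invfM; set b := _%:R; lra.
apply/cvg_lim => //.
rewrite (_ : dyadic_partial ^~ _ = fun n => x - iter n doubling x / 2 ^+ n).
  rewrite -[X in _ --> X]subr0; apply: cvgB; first exact: cvg_cst.
  apply: (@squeeze_cvgr _ _ _ _ (cst 0) (fun n => 2^-1 ^+ n)).
  - apply: nearW => n; have [/andP[D0 D1] _] := Dx n; apply/andP; split.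
      by rewrite divr_ge0 ?exprn_ge0 // ltW.
    by rewrite -exprVn ler_piMl // exprn_ge0.
  - exact: cvg_cst.
  - by apply: cvg_expr; rewrite ger0_norm; lra.
by apply/funext => n; have [] := Dx n.
Qed.

Lemma coin_measure_dyadic_value (a b : R) : 0 <= a -> a <= b -> b <= 1 ->
  coin_measure [set w | a < dyadic_value w <= b] = (b - a)%:E.
Proof.
move=> a0 ab b1; rewrite -unif_itv // /coin_measure /pushforward.
apply: unif_eq; apply/seteqP; split => x /=; rewrite !in_itv /= => -[+ x01];
  by rewrite dyadic_value_digits.
Qed.

End fair_coins.

(** What the construction of Poisson processes uses of the coins.  The maps
    [u \o ev \o iter n od] form a sequence of independent uniform variables,
    so a splitting source replaces an infinite product of probability spaces;
    statements about it are proved by structural recursion on [n]. *)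
Record splitting_source (R : realType) disp (Omega : measurableType disp)
    (P : probability Omega R) (ev od : Omega -> Omega) (u : Omega -> R) :
    Prop := {
  source_ev : measurable_fun setT ev ;
  source_od : measurable_fun setT od ;
  source_u : measurable_fun setT u ;
  source_split : forall A B, measurable A -> measurable B ->
    P (ev @^-1` A `&` od @^-1` B) = (P A * P B)%E ;
  source_unif : forall a b, 0 <= a -> a <= b -> b <= 1 ->
    P [set w | a < u w <= b] = (b - a)%:E }.

Lemma splitting_source_coins (R : realType) :
  splitting_source (coin_measure R) evens odds (@dyadic_value R).
Proof.
split; [exact: measurable_evens | exact: measurable_odds |
  exact: measurable_dyadic_value | exact: coin_measure_split |
  exact: coin_measure_dyadic_value].
Qed.

(** * Poisson masses *)
Section poisson_masses.
Context (R : realType).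
Implicit Types (a b : R) (n : nat).

(** Rate 0 is allowed and gives the unit mass at 0, so that empty windows need
    no separate treatment. *)
Definition poisson_mass a n : R := a ^+ n / n`!%:R * expR (- a).

Lemma poisson_mass_ge0 a n : 0 <= a -> 0 <= poisson_mass a n.
Proof. by move=> a0; rewrite !mulr_ge0 ?exprn_ge0 ?invr_ge0 ?expR_ge0. Qed.

Lemma poisson_mass0 n : poisson_mass 0 n = (n == 0%N)%:R.
Proof.
rewrite /poisson_mass oppr0 expR0 mulr1; case: n => [|n] /=.
  by rewrite expr0 fact0 divr1.
by rewrite expr0n mul0r.
Qed.

Lemma poisson_mass_convolution a b n :
  \sum_(i < n.+1) poisson_mass a i * poisson_mass b (n - i) = poisson_mass (a + b) n.
Proof.
rewrite /poisson_mass opprD expRD addrC exprDn [RHS]mulrAC mulrA.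
rewrite !mulr_suml; apply: eq_bigr => i _; have in_ : (i <= n)%N by rewrite -ltnS.
have F0 m : m`!%:R != 0 :> R by rewrite pnatr_eq0 -lt0n fact_gt0.
have := congr1 (fun k => k%:R : R) (bin_fact in_); rewrite !natrM => E.
rewrite -mulr_natr -E; field.
by rewrite !F0 /= pnatr_eq0 -lt0n bin_gt0.
Qed.

Lemma poisson_mass_series a : 0 <= a ->
  (\sum_(n <oo) (poisson_mass a n)%:E = 1)%E.
Proof.
move=> a0; apply/cvg_lim => //; rewrite -[1%E]/((1 : R)%:E).
rewrite (_ : (fun n => _) = EFin \o (fun n => series (exp_coeff a) n * expR (- a))).
  apply: cvg_EFin; first exact: nearW.
  rewrite (_ : fine \o _ = fun n => series (exp_coeff a) n * expR (- a)) //.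
  rewrite -(expRxMexpNx_1 a); apply: cvgMr_tmp.
  exact: is_cvg_series_exp_coeff.
apply/funext => n /=; rewrite sumEFin; congr EFin.
by rewrite /series /= mulr_suml; apply: eq_bigr.
Qed.

(** Both moments of the Poisson law follow from this and from the fact that its
    masses sum to 1. *)
Lemma poisson_mass_shift a n :
  n%:R * poisson_mass a n = a * (if n is m.+1 then poisson_mass a m else 0).
Proof.
case: n => [|n]; first by rewrite mul0r mulr0.
have F0 m : m`!%:R != 0 :> R by rewrite pnatr_eq0 -lt0n fact_gt0.
rewrite /poisson_mass factS natrM exprS; field.
by rewrite F0 nat1r pnatr_eq0.
Qed.

End poisson_masses.

(** * Discrete variables *)
Section total_probability.
Context d (T : measurableType d) (R : realType).
Variable P : probability T R.

Lemma total_probability_fin (J : finType) (X : T -> J) A :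
  measurable A -> (forall j, measurable [set w | X w = j]) ->
  P A = (\sum_(j : J) P (A `&` [set w | X w = j]))%E.
Proof.
move=> mA mX.
rewrite fsbig_seq ?index_enum_uniq // -measure_fin_bigcup.
- congr (P _); apply/seteqP; split=> [w Aw|w [j _ []]//].
  by exists (X w) => //=; rewrite mem_index_enum.
- exact: finite_finset.
- by move=> i j _ _ [w [[_ /= <-] [_ /= <-]]].
- by move=> j _; apply: measurableI.
Qed.

Lemma total_probability_nat (X : T -> nat) A :
  measurable A -> (forall j, measurable [set w | X w = j]) ->
  P A = (\sum_(j <oo) P (A `&` [set w | X w = j]))%E.
Proof.
move=> mA mX; rewrite -measure_semi_bigcup.
- congr (P _); apply/seteqP; split=> [w Aw|w [j _ []]//].
  by exists (X w).
- by move=> j; apply: measurableI.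
- by move=> i j _ _ [w [[_ /= <-] [_ /= <-]]].
- by apply: bigcupT_measurable => j; apply: measurableI.
Qed.

End total_probability.

Section discrete_variables.
Context d (T : measurableType d).

Lemma measurable_fiber (X : T -> nat) n :
  measurable_fun setT X -> measurable [set w | X w = n].
Proof. by move=> mX; have := mX measurableT [set n] I; rewrite setTI. Qed.

Lemma measurable_fun_fibers (X : T -> nat) :
  (forall n, measurable [set w | X w = n]) -> measurable_fun setT X.
Proof.
move=> mX _ Y _; rewrite setTI.
rewrite (_ : _ @^-1` _ = \bigcup_(n in Y) [set w | X w = n]).
  exact: bigcup_measurable.
by apply/seteqP; split => [w Yw|w [n Yn /= Xn]]; [exists (X w) | rewrite /= Xn].
Qed.

Lemma measurable_joint_fiber (J : finType) (X : J -> T -> nat) n :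
  (forall j, measurable_fun setT (X j)) ->
  measurable [set w | forall j, X j w = n j].
Proof.
move=> mX; rewrite (_ : [set _ | _] = \bigcap_(j in [set: J]) [set w | X j w = n j]).
  apply: fin_bigcap_measurable => [|j _]; first exact: finite_finset.
  exact: measurable_fiber.
by apply/seteqP; split => w /= H j; [move=> _|]; exact: H.
Qed.

End discrete_variables.

(** * Counts of Poisson many uniform points *)
Section point_counts.
Context (R : realType) disp (Omega : measurableType disp).
Context (P : probability Omega R) (ev od : Omega -> Omega) (u : Omega -> R).
Context (src : splitting_source P ev od u).

Let mev := source_ev src.
Let mod := source_od src.
Let mu := source_u src.
Let P_split := source_split src.
Let P_unif := source_unif src.

Let pr A : R := fine (P A).

Let prE A : measurable A -> P A = (pr A)%:E.
Proof. by move=> mA; rewrite /pr fineK // fin_num_measure. Qed.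

Let pre (f : Omega -> Omega) A : measurable_fun setT f -> measurable A ->
  measurable (f @^-1` A).
Proof. by move=> mf mA; rewrite -[X in measurable X]setTI; exact: mf. Qed.

Lemma measurable_u_itv a b : measurable [set w | a < u w <= b].
Proof.
rewrite (_ : [set _ | _] = u @^-1` `]a, b]).
  by rewrite -[X in measurable X]setTI; apply: mu => //; exact: measurable_itv.
by apply/seteqP; split => w /=; rewrite in_itv.
Qed.

Section poisson_number.
Context (lam : R) (lam0 : 0 <= lam).

Let cumul n : R := \sum_(i < n) poisson_mass lam i.

(** The quantile transform of the uniform variable; the default value is taken
    on a null set only. *)
Definition poisson_number (w : Omega) : nat :=
  xget 0%N [set n | cumul n < u w <= cumul n.+1].

Let cumul_le m n : (m <= n)%N -> cumul m <= cumul n.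
Proof.
move=> mn; rewrite /cumul -!(big_mkord xpredT (poisson_mass lam)).
rewrite (big_cat_nat (leq0n m) mn) //= lerDl sumr_ge0 // => i _.
exact: poisson_mass_ge0.
Qed.

Let cumul_le1 n : cumul n <= 1.
Proof.
rewrite -lee_fin -(poisson_mass_series lam0) /cumul -(big_mkord xpredT (poisson_mass lam)).
rewrite -sumEFin; apply: nneseries_lim_ge => i _.
by rewrite lee_fin poisson_mass_ge0.
Qed.

Let cell n := [set w | cumul n < u w <= cumul n.+1].

Let cell_uniq w m n : cell m w -> cell n w -> m = n.
Proof.
have lt i j : cell i w -> cell j w -> (j <= i)%N.
  move=> /andP[_ wi] /andP[jw _]; rewrite leqNgt; apply/negP => ij.
  by have := lt_le_trans jw (le_trans wi (cumul_le ij)); rewrite ltxx.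
by move=> wm wn; apply/eqP; rewrite eqn_leq !lt.
Qed.

Let P_cell n : P (cell n) = (poisson_mass lam n)%:E.
Proof.
rewrite P_unif //; first by rewrite /cumul big_ord_recr /= addrAC subrr add0r.
- by apply: sumr_ge0 => i _; exact: poisson_mass_ge0.
- exact: cumul_le.
Qed.

Let measurable_cells : measurable (\bigcup_n cell n).
Proof. by apply: bigcupT_measurable => n; exact: measurable_u_itv. Qed.

Let P_no_cell : P (~` \bigcup_n cell n) = 0%E.
Proof.
rewrite probability_setC // measure_semi_bigcup //.
- by rewrite (eq_eseriesr (fun n _ => P_cell n)) poisson_mass_series // subee.
- by move=> n; exact: measurable_u_itv.
- by move=> i j _ _ [w [wi wj]]; exact: cell_uniq wi wj.
Qed.

Let poisson_number_fiber n : [set w | poisson_number w = n] =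
  cell n `|` (if n == 0%N then ~` \bigcup_n cell n else set0).
Proof.
apply/seteqP; split => w /=.
  rewrite /poisson_number; case: xgetP => [k -> kw <-|]; first by left.
  move=> H <-; right => /= -[k _ kw]; exact: (H k).
move=> [wn|].
  rewrite /poisson_number; case: xgetP => [k _ kw|H].
    exact: cell_uniq kw wn.
  by case: (H _ wn).
case: eqP => // -> Hw; rewrite /poisson_number; case: xgetP => // k _ kw.
by case: Hw; exists k.
Qed.

Lemma measurable_poisson_number n : measurable [set w | poisson_number w = n].
Proof.
rewrite poisson_number_fiber; apply: measurableU; first exact: measurable_u_itv.
by case: ifP => _ //; exact: measurableC.
Qed.

Lemma P_poisson_number n :
  P [set w | poisson_number w = n] = (poisson_mass lam n)%:E.
Proof.
rewrite poisson_number_fiber measureU0 //.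
- exact: P_cell.
- exact: measurable_u_itv.
- by case: ifP => _ //; exact: measurableC.
- by case: ifP => _; rewrite ?measure0 // P_no_cell.
Qed.

End poisson_number.

Fixpoint uniform_points m (w : Omega) : seq R :=
  if m is m'.+1 then u (ev w) :: uniform_points m' (od w) else [::].

Lemma size_uniform_points m w : size (uniform_points m w) = m.
Proof. by elim: m w => //= m IH w; rewrite IH. Qed.

Section classes.
Context (J : finType) (cl : R -> J).
Context (mcl : forall j, measurable [set w | cl (u w) = j]).

Let p j := pr [set w | cl (u w) = j].

Lemma sum_class_probability : \sum_j p j = 1.
Proof.
apply: EFin_inj; rewrite -sumEFin -[RHS](probability_setT P).
rewrite (total_probability_fin P (X := fun w => cl (u w)) measurableT mcl).
by apply: eq_bigr => j _; rewrite setTI prE.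
Qed.

Lemma measurable_count_points (f : R -> bool) m n :
  measurable [set w | f (u w)] ->
  measurable [set w | count f (uniform_points m w) = n].
Proof.
move=> mf; elim: m n => [|m IH] n.
  by case: (eqVneq n 0%N) => [->|n0]; [rewrite (_ : [set _ | _] = setT) //|
    rewrite (_ : [set _ | _] = set0) //]; apply/seteqP; split=> // w /= /esym/eqP;
    rewrite (negbTE n0).
rewrite (_ : [set _ | _] =
  (ev @^-1` [set w | f (u w)] `&` od @^-1` [set w | (count f (uniform_points m w)).+1 = n])
  `|` (ev @^-1` (~` [set w | f (u w)]) `&`
       od @^-1` [set w | count f (uniform_points m w) = n])).
  apply: measurableU; apply: measurableI; apply: pre => //.
  - case: n => [|n]; last by rewrite (_ : [set _ | _] =
      [set w | count f (uniform_points m w) = n]) //; apply/seteqP; split => w /=;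
      [case|move=> ->].
    by rewrite (_ : [set _ | _] = set0) //; apply/seteqP; split.
  - exact: measurableC.
apply/seteqP; split => w /=.
  by case: (boolP (f _)) => fw <-; [left|right].
by move=> [[-> <-]|[/negP/negbTE -> <-]].
Qed.

Let class_counts m (n : J -> nat) :=
  [set w | forall j, count (fun v => cl v == j) (uniform_points m w) = n j].

Lemma measurable_class_counts m n : measurable (class_counts m n).
Proof.
rewrite (_ : class_counts _ _ = \bigcap_(j in [set: J])
  [set w | count (fun v => cl v == j) (uniform_points m w) = n j]).
  apply: fin_bigcap_measurable => [|j _]; first exact: finite_finset.
  apply: measurable_count_points.
  rewrite (_ : [set _ | _] = [set w | cl (u w) = j]) //.
  by apply/seteqP; split => w /= /eqP.
by apply/seteqP; split => w /= H j; [move=> _|]; exact: H.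
Qed.

(** The multinomial formula, by induction on the number of points: conditioning
    on the class [i] of the first one lowers [n i] by one, and
    [p i * (p i ^+ n / n`!) = n.+1 * (p i ^+ n.+1 / n.+1`!)] turns the sum over
    [i] into the factor [\sum_i n i = m.+1]. *)
Lemma P_class_counts m (n : J -> nat) :
  P (class_counts m n) = (if (\sum_j n j)%N == m then
    m`!%:R * \prod_j (p j ^+ n j / (n j)`!%:R) else 0)%:E.
Proof.
elim: m n => [|m IH] n.
  case: ifP => [|s0].
    rewrite sum_nat_eq0 => /forallP n0.
    rewrite (_ : class_counts _ _ = setT); last first.
      by apply/seteqP; split => // w _ j /=; apply/esym/eqP; exact: n0.
    rewrite probability_setT big1 ?mulr1 // => j _.
    by rewrite (eqP (n0 j)) expr0 fact0 divr1.
  rewrite (_ : class_counts _ _ = set0) ?measure0 //.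
  apply/seteqP; split => // w /= H; move: s0; rewrite sum_nat_eq0.
  by move=> /forallP; apply => j; rewrite -H.
pose pred_at i j := (n j - (j == i))%N.
rewrite (total_probability_fin P (X := fun w => cl (u (ev w)))); first last.
- by move=> j; exact: (pre mev (mcl j)).
- exact: measurable_class_counts.
rewrite (eq_bigr (fun i => (if (0 < n i)%N && ((\sum_j n j)%N == m.+1) then
    m`!%:R * ((n i)%:R * \prod_j (p j ^+ n j / (n j)`!%:R)) else 0)%:E)); last first.
  move=> i _; case: (posnP (n i)) => [ni0|ni] /=.
    rewrite (_ : _ `&` _ = set0) ?measure0 //.
    apply/seteqP; split => // w /= [/(_ i) + wi].
    by rewrite /= wi eqxx ni0.
  rewrite setIC (_ : _ `&` _ = ev @^-1` [set w | cl (u w) = i] `&`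
                      od @^-1` class_counts m (pred_at i)); last first.
    apply/seteqP; split => w /= [wi H]; split => // j; have := H j;
      rewrite /pred_at /= wi [i == j]eq_sym; first by move=> <-; rewrite addKn.
    by move=> ->; rewrite subnKC //; case: eqP => // ->.
  rewrite P_split //; last exact: measurable_class_counts.
  rewrite IH prE // -/(p i) -EFinM; congr EFin.
  have -> : (\sum_j pred_at i j == m)%N = (\sum_j n j == m.+1)%N.
    rewrite (bigD1 i) //= [X in _ = (X == _)](bigD1 i) //= /pred_at eqxx.
    rewrite (eq_bigr n); first by rewrite -eqSS -addSn subn1 prednK.
    by move=> j /negbTE ->; rewrite subn0.
  case: ifP => _; last by rewrite mulr0.
  rewrite mulrCA; congr (_ * _).
  rewrite (bigD1 i) //= [X in _ = _ * X](bigD1 i) //= !mulrA.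
  congr (_ * _); last by apply: eq_bigr => j /negbTE ji; rewrite /pred_at ji subn0.
  rewrite /pred_at eqxx subn1; case: (n i) ni => // k _ /=.
  rewrite factS natrM exprS; field.
  by rewrite !pnatr_eq0 -!lt0n fact_gt0 /= nat1r pnatr_eq0.
rewrite sumEFin; congr EFin; case: eqP => [sn|_]; last first.
  by apply: big1 => i _; rewrite andbF.
transitivity (\sum_i (n i)%:R * (m`!%:R * \prod_j (p j ^+ n j / (n j)`!%:R))).
  by apply: eq_bigr => i _; rewrite andbT mulrCA; case: (n i) => [|k] //=;
    rewrite mul0r.
by rewrite -mulr_suml -natr_sum sn factS natrM mulrA.
Qed.

End classes.

Context (lam : R) (lam0 : 0 <= lam).

(** The number of points and their positions are read from the two halves of
    [w], which makes them independent. *)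
Definition unit_points (w : Omega) : seq R :=
  uniform_points (poisson_number lam (ev w)) (od w).

Lemma measurable_count_unit_points (f : R -> bool) :
  measurable [set w | f (u w)] ->
  measurable_fun setT (fun w => count f (unit_points w)).
Proof.
move=> mf; apply: measurable_fun_fibers => n.
rewrite (_ : [set _ | _] = \bigcup_m (ev @^-1` [set w | poisson_number lam w = m]
  `&` od @^-1` [set w | count f (uniform_points m w) = n])).
  apply: bigcupT_measurable => m; apply: measurableI; apply: pre => //.
    exact: measurable_poisson_number.
  exact: measurable_count_points.
apply/seteqP; split => [w wn|w [m _ [/= wm <-]]].
  by exists (poisson_number lam (ev w)).
by rewrite /unit_points wm.
Qed.

Lemma sum_count_classes (J : finType) (cl : R -> J) s :
  (\sum_j count (fun v => cl v == j) s)%N = size s.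
Proof.
elim: s => [|v s IH] /=; first by rewrite big1.
by rewrite big_split /= IH (bigD1 (cl v)) //= eqxx big1 // => j /negbTE; rewrite eq_sym => ->.
Qed.

(** Since the classes cover all points, prescribing every count prescribes the
    total number of points: the mixture over the Poisson total has a single
    term, and no series has to be summed. *)
Lemma P_unit_counts (J : finType) (cl : R -> J) (n : J -> nat) :
  (forall j, measurable [set w | cl (u w) = j]) ->
  P [set w | forall j, count (fun v => cl v == j) (unit_points w) = n j] =
  (\prod_j poisson_mass (lam * pr [set w | cl (u w) = j]) (n j))%:E.
Proof.
move=> mcl; set N := (\sum_j n j)%N.
rewrite (_ : [set _ | _] = ev @^-1` [set w | poisson_number lam w = N] `&`
  od @^-1` [set w | forall j, count (fun v => cl v == j) (uniform_points N w) = n j]).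
  rewrite P_split //.
  - rewrite P_poisson_number // P_class_counts // eqxx -EFinM; congr EFin.
    have EL : lam = \sum_j lam * pr [set w | cl (u w) = j].
      by rewrite -mulr_sumr sum_class_probability // mulr1.
    rewrite {1}/poisson_mass [X in expR (- X)]EL -sumrN expR_sum -prodrXr.
    have F0 : N`!%:R != 0 :> R by rewrite pnatr_eq0 -lt0n fact_gt0.
    rewrite mulrACA [_ / _ * _](mulfVK F0) -!big_split; apply: eq_bigr => j _.
    by rewrite /poisson_mass exprMn /= mulrCA mulrC !mulrA.
  - exact: measurable_poisson_number.
  - exact: measurable_class_counts.
apply/seteqP; split => w /=.
  move=> H; have EN : poisson_number lam (ev w) = N.
    rewrite -(size_uniform_points (poisson_number lam (ev w)) (od w)).
    by rewrite -(sum_count_classes cl); apply: eq_bigr => j _; exact: H.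
  by split=> // j; rewrite -EN; exact: H.
by move=> [EN H] j; rewrite /unit_points EN.
Qed.

(** The unit of rank [m] is read from [ev (iter m od w)] and its points are
    counted by [f m]. *)
Fixpoint total_count K (f : nat -> R -> bool) (w : Omega) : nat :=
  if K is K'.+1 then
    (count (f 0%N) (unit_points (ev w)) +
     total_count K' (fun m => f m.+1) (od w))%N
  else 0%N.

Lemma measurable_total_count K (f : nat -> R -> bool) :
  (forall m, measurable [set w | f m (u w)]) ->
  measurable_fun setT (total_count K f).
Proof.
elim: K f => [|K IH] f mf /=; first exact: measurable_cst.
apply: measurable_fun_addn.
  exact: (measurableT_comp (measurable_count_unit_points (mf 0%N)) mev).
by apply: (measurableT_comp (IH _ _) mod) => m; exact: mf.
Qed.

(** Adding one unit convolves two product laws.  The convolution is a finite sum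
    over vectors below [n], which factors over the coordinates. *)
Lemma P_total_classes (J : finType) K (cl : nat -> R -> J) (n : J -> nat) :
  (forall m j, measurable [set w | cl m (u w) = j]) ->
  P [set w | forall j, total_count K (fun m v => cl m v == j) w = n j] =
  (\prod_j poisson_mass (\sum_(m < K) lam * pr [set w | cl m (u w) = j]) (n j))%:E.
Proof.
have mcl' (cl' : nat -> R -> J) : (forall m j, measurable [set w | cl' m (u w) = j]) ->
    forall m j, measurable [set w | cl' m (u w) == j].
  move=> mcl m j; rewrite (_ : [set _ | _] = [set w | cl' m (u w) = j]) //.
  by apply/seteqP; split => w /= /eqP.
elim: K cl n => [|K IH] cl n mcl /=.
  under eq_bigr do rewrite big_ord0 poisson_mass0.
  case: (boolP [forall j, n j == 0%N]) => [/forallP n0|].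
    rewrite (_ : [set _ | _] = setT); last first.
      by apply/seteqP; split => // w _ j /=; apply/esym/eqP; exact: n0.
    by rewrite probability_setT big1 // => j _; rewrite n0.
  rewrite negb_forall => /existsP[j nj].
  rewrite (_ : [set _ | _] = set0) ?measure0; last first.
    by apply/seteqP; split => // w /= /(_ j) /esym/eqP; apply/negP.
  by rewrite (bigD1 j) //= (negbTE nj) mul0r.
pose X j w := count (fun v => cl 0%N v == j) (unit_points w).
pose Y j w := total_count K (fun m v => cl m.+1 v == j) w.
have mX j : measurable_fun setT (X j).
  exact: (measurable_count_unit_points (mcl' _ mcl 0%N j)).
have mY j : measurable_fun setT (Y j).
  exact: (measurable_total_count _ (fun m => mcl' _ mcl m.+1 j)).
have mXev j : measurable_fun setT (fun w => X j (ev w)).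
  exact: (measurableT_comp (mX j) mev).
have mYod j : measurable_fun setT (fun w => Y j (od w)).
  exact: (measurableT_comp (mY j) mod).
set A := [set _ | _].
have mA : measurable A.
  apply: (measurable_joint_fiber (X := fun j w => (X j (ev w) + Y j (od w))%N)).
  by move=> j; exact: measurable_fun_addn.
pose N := (\max_j n j)%N.
have nN j : (n j <= N)%N by exact: leq_bigmax.
(* On the event A the counts of the first unit are at most N, so truncating
   them there loses nothing and makes the conditioning finite. *)
pose Z w : {ffun J -> 'I_N.+1} := [ffun j => inord (X j (ev w))].
have mZ x : measurable [set w | Z w = x].
  rewrite (_ : [set _ | _] = [set w | forall j, (inord (X j (ev w)) : 'I_N.+1) = x j :> nat]).
    apply: measurable_joint_fiber => j.
    exact: (measurableT_comp (f := fun k => nat_of_ord (inord k : 'I_N.+1)) _ (mXev j)).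
  apply/seteqP; split => w /=; first by move=> <- j; rewrite ffunE.
  by move=> H; apply/ffunP => j; rewrite ffunE; apply/val_inj/H.
pose a j := lam * pr [set w | cl 0%N (u w) = j].
pose b j := \sum_(m < K) lam * pr [set w | cl m.+1 (u w) = j].
rewrite (total_probability_fin P mA mZ).
transitivity (\sum_(x : {ffun J -> 'I_N.+1}) (\prod_j
    (if (x j <= n j)%N then poisson_mass (a j) (x j) * poisson_mass (b j) (n j - x j) else 0))%:E)%E.
  apply: eq_bigr => x _.
  case: (boolP [forall j, (x j <= n j)%N]) => [/forallP xn|]; last first.
    rewrite negb_forall => /existsP[j xj].
    rewrite (bigD1 j) //= (negbTE xj) mul0r.
    rewrite (_ : _ `&` _ = set0) ?measure0 //; apply/seteqP; split => // w.
    move=> [/(_ j) E Zx].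
    have Xn : (X j (ev w) <= n j)%N by rewrite -E leq_addr.
    by move: xj; rewrite -Zx ffunE inordK ?Xn // ltnS (leq_trans Xn).
  rewrite (_ : _ `&` _ = ev @^-1` [set w | forall j, X j w = x j] `&`
    od @^-1` [set w | forall j, Y j w = (n j - x j)%N]).
    rewrite P_split; [|exact: measurable_joint_fiber..].
    rewrite (P_unit_counts _ (mcl 0%N)) (IH (fun m => cl m.+1)) //.
    rewrite -EFinM -big_split; congr EFin; apply: eq_bigr => j _ /=.
    by rewrite xn.
  apply/seteqP; split => w /=.
    move=> [H Zx]; have EX j : X j (ev w) = x j.
      rewrite -Zx ffunE inordK // ltnS (leq_trans _ (nN j)) // -(H j).
      exact: leq_addr.
    by split => // j; rewrite -EX -(H j) addKn.
  move=> [EX EY]; split => [j|].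
    by rewrite -/(X j _) -/(Y j _) EX EY subnKC.
  by apply/ffunP => j; rewrite ffunE EX; apply/val_inj; rewrite /= inordK.
rewrite sumEFin; congr EFin.
rewrite -(bigA_distr_bigA (fun j (i : 'I_N.+1) =>
  if (i <= n j)%N then poisson_mass (a j) i * poisson_mass (b j) (n j - i) else 0)).
apply: eq_bigr => j _.
rewrite [X in poisson_mass X _](_ : _ = a j + b j); last by rewrite big_ord_recl.
rewrite -poisson_mass_convolution.
rewrite (big_ord_widen N.+1 (fun i => poisson_mass (a j) i * poisson_mass (b j) (n j - i))).
  by rewrite [RHS]big_mkcond.
exact: nN.
Qed.

Lemma eq_total_count K f g : (forall m v, f m v = g m v) ->
  total_count K f =1 total_count K g.
Proof.
by move=> fg w; congr total_count; apply/funext => m; apply/funext => v.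
Qed.

(** Disjoint classes that need not cover everything are completed by one more
    class, whose Poisson count is then summed out. *)
Lemma P_total_counts (I : finType) K (F : I -> nat -> R -> bool)
    (n : I -> nat) :
  (forall m c c' v, F c m v -> F c' m v -> c = c') ->
  (forall m c, measurable [set w | F c m (u w)]) ->
  P [set w | forall c, total_count K (F c) w = n c] =
  (\prod_c poisson_mass (\sum_(m < K) lam * pr [set w | F c m (u w)]) (n c))%:E.
Proof.
move=> dF mF.
pose cl m v := [pick c | F c m v].
have clE m v c : (cl m v == Some c) = F c m v.
  rewrite /cl; case: pickP => [c' Fc'|/(_ c) -> //].
  apply/eqP/idP => [[<-]//|Fc]; congr Some; exact: dF Fc' Fc.
have setE m c : [set w | cl m (u w) = Some c] = [set w | F c m (u w)].
  by apply/seteqP; split => w /=; rewrite -clE => /eqP.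
have mcl m j : measurable [set w | cl m (u w) = j].
  case: j => [c|]; first by rewrite setE.
  rewrite (_ : [set _ | _] = ~` \bigcup_(c in [set: I]) [set w | F c m (u w)]).
    apply: measurableC; apply: fin_bigcup_measurable => [|c _]; last exact: mF.
    exact: finite_finset.
  apply/seteqP; split => w /=.
    by move=> E [c _] /=; rewrite -clE E.
  move=> H; case E : (cl m (u w)) => [c|] //; case: H; exists c => //=.
  by rewrite -clE E.
pose None_count := total_count K (fun m v => cl m v == None).
have mNone : measurable_fun setT None_count.
  apply: measurable_total_count => m.
  rewrite (_ : [set _ | _] = [set w | cl m (u w) = None]) //.
  by apply/seteqP; split => w /= /eqP.
have mF' c : measurable_fun setT (total_count K (F c)).
  by apply: measurable_total_count => m; exact: mF.
pose a j := \sum_(m < K) lam * pr [set w | cl m (u w) = j].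
rewrite (total_probability_nat P (X := None_count)); first last.
- by move=> l; exact: measurable_fiber.
- exact: measurable_joint_fiber.
transitivity (\sum_(l <oo) ((\prod_c poisson_mass (a (Some c)) (n c))%:E * (poisson_mass (a None) l)%:E))%E.
  apply: eq_eseriesr => l _; pose n' j := if j is Some c then n c else l.
  rewrite (_ : _ `&` _ = [set w | forall j,
      total_count K (fun m v => cl m v == j) w = n' j]).
    rewrite P_total_classes // (bigD1 None) //= mulrC EFinM; congr (_%:E * _)%E.
    rewrite (reindex_omap Some id) /=; last by case.
    by apply: eq_bigl => c; rewrite eqxx.
  have ext c w : total_count K (F c) w = total_count K (fun m v => cl m v == Some c) w.
    by apply: eq_total_count => m v; rewrite clE.
  apply/seteqP; split => w /=; first by move=> [H Hl] [c|] //=; rewrite -ext.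
  by move=> H; split => [c|]; [rewrite ext; exact: (H (Some c)) | exact: (H None)].
rewrite nneseriesZl; last first.
  move=> l _; rewrite lee_fin poisson_mass_ge0 //; apply: sumr_ge0 => m _.
  by rewrite mulr_ge0 // fine_ge0.
rewrite poisson_mass_series ?mule1; last first.
  by apply: sumr_ge0 => m _; rewrite mulr_ge0 // fine_ge0.
congr EFin; apply: eq_bigr => c _; congr poisson_mass.
by apply: eq_bigr => m _; rewrite setE.
Qed.



Lemma total_count_stable K K' (f : nat -> R -> bool) w : (K <= K')%N ->
  (forall m v, (K <= m)%N -> f m v = false) ->
  total_count K' f w = total_count K f w.
Proof.
elim: K' K f w => [|K' IH] [|K] f w // KK' f0 /=.
  rewrite (eq_count (a2 := xpred0)) => [|v]; last exact: f0.
  by rewrite count_pred0 (IH 0%N) // => m v _; exact: f0.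
by rewrite (IH K) // => m v Km; exact: f0.
Qed.

Lemma total_countD K (f g h : nat -> R -> bool) w :
  (forall m v, (h m v : nat) = (f m v + g m v)%N) ->
  total_count K h w = (total_count K f w + total_count K g w)%N.
Proof.
elim: K f g h w => [|K IH] f g h w fgh //=.
rewrite (IH (fun m => f m.+1) (fun m => g m.+1)) // addnACA; congr (_ + _)%N.
by elim: (unit_points _) => //= v s ->; rewrite fgh addnACA.
Qed.

Lemma near_total_count (F : set_system R) {FF : Filter F} K
    (f : R -> nat -> R -> bool) (g : nat -> R -> bool) w :
  (forall m v, \forall s \near F, f s m v = g m v) ->
  \forall s \near F, total_count K (f s) w = total_count K g w.
Proof.
elim: K f g w => [|K IH] f g w fg /=; first exact: nearW.
have fgK := IH (fun s m => f s m.+1) (fun m => g m.+1) (od w) (fun m => fg m.+1).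
have fg0 : \forall s \near F,
    count (f s 0%N) (unit_points (ev w)) = count (g 0%N) (unit_points (ev w)).
  elim: (unit_points _) => [|v s' IHs] /=; first exact: nearW.
  by apply: filterS2 (fg 0%N v) IHs => s -> ->.
by apply: filterS2 fg0 fgK => s -> ->.
Qed.

End point_counts.

(** * Poisson processes *)
Section clamp.
Context (R : realType).

(** [clamp (t - m)] is the part of the unit of time [[m, m + 1]] that is over at
    time [t]. *)
Definition clamp (x : R) : R := Num.max 0 (Num.min x 1).

Lemma clamp_ge0 x : 0 <= clamp x. Proof. by rewrite le_max lexx. Qed.

Lemma clamp_le1 x : clamp x <= 1.
Proof. by rewrite ge_max ler01 ge_min lexx orbT. Qed.

Lemma le_clamp x y : x <= y -> clamp x <= clamp y.
Proof.
move=> xy; rewrite /clamp ge_max !le_max lexx /=; apply/orP; right.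
by rewrite le_min !ge_min xy lexx orbT.
Qed.

Lemma lt_clamp x y : 0 < y -> y <= 1 -> (clamp x < y) = (x < y).
Proof.
by move=> y0 y1; rewrite gt_max y0 /= gt_min [1 < y]ltNge y1 orbF.
Qed.

Lemma sum_clamp K t : 0 <= t -> \sum_(m < K) clamp (t - m%:R) = Num.min t K%:R.
Proof.
move=> t0; elim: K => [|K IH]; first by rewrite big_ord0 min_r.
rewrite big_ord_recr /= IH -natr1; set k := K%:R; rewrite /clamp.
case: (leP t k) => tk.
  by rewrite max_l ?addr0 ?ge_min ?subr_le0 ?tk // min_l //; lra.
case: (leP t (k + 1)) => tk1; last by rewrite [Num.min (t - k) 1]min_r ?max_r //; lra.
by rewrite [Num.min (t - k) 1]min_l ?max_r //; lra.
Qed.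

End clamp.

Section poisson_processes.
Context (R : realType) disp (Omega : measurableType disp).
Context (P : probability Omega R) (ev od : Omega -> Omega) (u : Omega -> R).
Context (src : splitting_source P ev od u).

Let mu := source_u src.
Let P_unif := source_unif src.
Context (lam : R) (lam0 : 0 <= lam).
Local Notation total_count := (total_count ev od u lam).

Context (k : nat).
Let q : R := k.+1%:R.
Let q0 : 0 < q. Proof. by rewrite ltr0n. Qed.

(** Points are rescaled from ]0, 1] to ]0, k + 1]; a point of ]j, j + 1] is a jump
    of type [j], and what exceeds [j] is the time of the jump inside its unit.
    Having [k.+1] cells rather than [k] keeps the case of no types regular. *)
Definition has_type j (v : R) : bool := j%:R < k.+1%:R * v <= j%:R + 1.

Definition jump_time j m (v : R) : R := m%:R + (k.+1%:R * v - j%:R).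

(** Jumps of the unit [m] happen after time [m], so counting the units up to the
    integer part of [t] is enough; [typed_countE] allows any larger number of
    units, uniformly in a neighbourhood of [t]. *)
Definition typed_count j (t : R) (w : Omega) : nat :=
  total_count (Num.truncn t).+1
    (fun m v => has_type j v && (jump_time j m v <= t)) w.

Let jump_time_gt j m v t : has_type j v -> t <= m%:R -> t < jump_time j m v.
Proof. by rewrite /has_type /jump_time => /andP[? ?] ?; lra. Qed.

Lemma typed_countE j t K w : t < K%:R ->
  typed_count j t w =
  total_count K (fun m v => has_type j v && (jump_time j m v <= t)) w.
Proof.
move=> tK; pose f m v := has_type j v && (jump_time j m v <= t).
have f0 n : t < n%:R -> forall m v, (n <= m)%N -> f m v = false.
  move=> tn m v nm; rewrite /f; case: (boolP (has_type j v)) => //= jv.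
  apply/negbTE; rewrite -ltNge jump_time_gt //.
  by rewrite (le_trans (ltW tn)) // ler_nat.
have tT : t < (Num.truncn t).+1%:R by exact: truncnS_gt.
rewrite /typed_count -/f; case: (leqP K (Num.truncn t).+1) => KK.
  by rewrite (total_count_stable ev od u lam w KK) //; exact: f0.
by rewrite [RHS](total_count_stable ev od u lam w (ltnW KK)) //; exact: f0.
Qed.

Lemma typed_count_increment j s t K w : s <= t -> t < K%:R ->
  typed_count j t w = (typed_count j s w +
    total_count K (fun m v => has_type j v && (s < jump_time j m v <= t)%R) w)%N.
Proof.
move=> st tK; rewrite (typed_countE _ _ tK) (typed_countE _ _ (le_lt_trans st tK)).
apply: total_countD => m v; case: (has_type j v) => //=.
case: (lerP (jump_time j m v) s) => [js|js] //=.
by rewrite (le_trans js st).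
Qed.

Lemma typed_count_nondecreasing j s t w : s <= t ->
  (typed_count j s w <= typed_count j t w)%N.
Proof.
move=> st; rewrite (typed_count_increment _ _ st (truncnS_gt t)).
exact: leq_addr.
Qed.

Lemma typed_count0 j w : typed_count j 0 w = 0%N.
Proof.
rewrite (@typed_countE _ _ 1%N) ?ltr01 // (total_count_stable ev od u lam w (leq0n 1)) // => m v _.
case: (boolP (has_type j v)) => //= jv; apply/negbTE.
by rewrite -ltNge jump_time_gt.
Qed.

Lemma typed_count_right j t w :
  \forall s \near t^'+, typed_count j s w = typed_count j t w.
Proof.
have tK := truncnS_gt t; set K := (Num.truncn t).+1 in tK.
have near_count := near_total_count ev od u lam (F := t^'+) K
  (f := fun s m v => has_type j v && (jump_time j m v <= s))
  (g := fun m v => has_type j v && (jump_time j m v <= t)) w.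
have : \forall s \near t^'+, total_count K
    (fun m v => has_type j v && (jump_time j m v <= s)) w = typed_count j t w.
  apply: near_count => m v; case: (has_type j v) => /=; last exact: nearW.
  case: (lerP (jump_time j m v) t) => jt.
    near=> s; apply: (le_trans jt); near: s; exact: nbhs_right_ge.
  by near=> s; apply/negbTE; rewrite -ltNge; near: s; exact: nbhs_right_lt.
apply: filterS2 (nbhs_right_lt tK) => s sK <-; exact: typed_countE.
Unshelve. all: by end_near. Qed.

Lemma typed_count_left j t w :
  exists n, \forall s \near t^'-, typed_count j s w = n.
Proof.
have tK := truncnS_gt t; set K := (Num.truncn t).+1 in tK.
exists (total_count K (fun m v => has_type j v && (jump_time j m v < t)) w).
have near_count := near_total_count ev od u lam (F := t^'-) K
  (f := fun s m v => has_type j v && (jump_time j m v <= s))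
  (g := fun m v => has_type j v && (jump_time j m v < t)) w.
have : \forall s \near t^'-, total_count K
    (fun m v => has_type j v && (jump_time j m v <= s)) w =
    total_count K (fun m v => has_type j v && (jump_time j m v < t)) w.
  apply: near_count => m v; case: (has_type j v) => /=; last exact: nearW.
  case: (ltP (jump_time j m v) t) => jt.
    by near=> s; apply: ltW; near: s; exact: nbhs_left_gt.
  near=> s; apply/negbTE; rewrite -ltNge; apply: lt_le_trans jt.
  by near: s; exact: nbhs_left_lt.
apply: filterS2 (nbhs_left_lt t) => s st <-.
exact/typed_countE/(lt_trans st).
Unshelve. all: by end_near. Qed.

(** In a single unit, the window of type [j] and time interval ]s, t] is an
    interval. *)
Let windowE j s t m v :
  (has_type j v && (s < jump_time j m v <= t)) =
  ((j%:R + clamp (s - m%:R)) / q < v <= (j%:R + clamp (t - m%:R)) / q).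
Proof.
rewrite ltr_pdivrMr // ler_pdivlMr // mulrC -/q /has_type -/q /jump_time -/q.
set x := q * v - j%:R.
have -> : (j%:R + clamp (s - m%:R) < q * v) = (clamp (s - m%:R) < x).
  by rewrite /x ltrBrDl.
have -> : (q * v <= j%:R + clamp (t - m%:R)) = ~~ (clamp (t - m%:R) < x).
  by rewrite -leNgt /x lerBlDl.
have -> : (j%:R < q * v <= j%:R + 1) = (0 < x <= 1).
  by rewrite /x subr_gt0 lerBlDl.
case: (ltP 0 x) => x0 /=; last first.
  by rewrite ltNge (le_trans x0) ?clamp_ge0.
case: (lerP x 1) => x1 /=; last first.
  by rewrite (le_lt_trans (clamp_le1 (t - m%:R)) x1) andbF.
by rewrite !lt_clamp // ltrBlDl -leNgt lerBrDl.
Qed.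

Let windowP j s t m : (j <= k)%N -> s <= t ->
  P [set w | has_type j (u w) && (s < jump_time j m (u w) <= t)] =
  ((clamp (t - m%:R) - clamp (s - m%:R)) / q)%:E.
Proof.
move=> jk st; under [X in P X]eq_set do rewrite windowE.
have c0 x := clamp_ge0 (x : R); have c1 x := clamp_le1 (x : R).
have cc : clamp (s - m%:R) <= clamp (t - m%:R) by rewrite le_clamp ?lerB.
rewrite P_unif; first by congr EFin; field; rewrite gt_eqF.
- by rewrite divr_ge0 ?(ltW q0) // addr_ge0.
- by rewrite ler_pM2r ?invr_gt0 // lerD2l.
- rewrite ler_pdivrMr // mul1r /q -natr1 lerD //.
  by rewrite ler_nat.
Qed.

Let measurable_window j s t m :
  measurable [set w | has_type j (u w) && (s < jump_time j m (u w) <= t)].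
Proof. by under eq_set do rewrite windowE; exact: (measurable_u_itv src). Qed.

Lemma measurable_typed_count j t : measurable_fun setT (typed_count j t).
Proof.
apply: (measurable_total_count src lam0) => m.
have mj : measurable_fun setT (fun w => jump_time j m (u w)).
  apply: measurable_funD => //; apply: measurable_funB => //.
  exact: measurable_funM.
have mi : measurable_fun setT (fun w => has_type j (u w)).
  have mq : measurable_fun setT (fun w => k.+1%:R * u w) by exact: measurable_funM.
  by apply: measurable_and; [exact: measurable_fun_ltr | exact: measurable_fun_ler].
have := measurable_and mi (measurable_fun_ler mj (measurable_cst t)).
by move=> /(_ measurableT [set true] I); rewrite setTI.
Qed.

(** Stated for a subfamily [ty] of the types, so that the law of one or two of
    the processes is an instance rather than a marginal. *)
Lemma P_typed_increments n (tau : nat -> R) (J : finType) (ty : J -> nat)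
    (v : 'I_n -> J -> nat) :
  injective ty -> (forall j, (ty j <= k)%N) ->
  0 <= tau 0%N -> (forall i, (i < n)%N -> tau i <= tau i.+1) ->
  P [set w | forall (i : 'I_n) j, typed_count (ty j) (tau i.+1) w =
                                  (typed_count (ty j) (tau i) w + v i j)%N] =
  (\prod_(i < n) \prod_j poisson_mass (lam / q * (tau i.+1 - tau i)) (v i j))%:E.
Proof.
move=> ty_inj ty_le tau0 tauS.
have tau_le i i' : (i <= i')%N -> (i' <= n)%N -> tau i <= tau i'.
  elim: i' => [|i' IH]; first by rewrite leqn0 => /eqP ->.
  rewrite leq_eqVlt => /predU1P[-> //|ii'] i'n.
  by rewrite (le_trans (IH ii' (ltnW i'n))) // tauS.
pose K := (Num.truncn (tau n)).+1.
have tauK i : (i <= n)%N -> tau i < K%:R.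
  by move=> i_n; rewrite (le_lt_trans (tau_le _ _ i_n _)) // truncnS_gt.
pose F (c : 'I_n * J) m x :=
  has_type (ty c.2) x && (tau c.1 < jump_time (ty c.2) m x <= tau c.1.+1).
rewrite (_ : [set _ | _] = [set w | forall c, total_count K (F c) w = v c.1 c.2]).
  rewrite (P_total_counts src lam0); last by move=> m c; exact: measurable_window.
    rewrite pair_big; congr EFin; apply: eq_bigr => -[i j] _ /=; congr poisson_mass.
    rewrite -mulr_sumr -mulrA; congr (_ * _).
    transitivity (\sum_(m < K) ((clamp (tau i.+1 - m%:R) - clamp (tau i - m%:R)) / q)).
      apply: eq_bigr => m _; rewrite windowP //.
      exact: tauS.
    rewrite -mulr_suml sumrB !sum_clamp.
    - by rewrite !min_l ?ltW ?tauK // 1?mulrC // ltnW.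
    - by rewrite (le_trans tau0) // tau_le // ltnW.
    - by rewrite (le_trans tau0) // tau_le.
  move=> m [i j] [i' j'] x /andP[/= jx ix] /andP[/= jx' ix'].
  have cellI a b : has_type a x -> has_type b x -> (a <= b)%N.
    rewrite /has_type => /andP[ax _] /andP[_ bx]; rewrite -ltnS.
    by rewrite -(ltr_nat R) -natr1 (lt_le_trans ax).
  have jj : j = j' by apply/ty_inj/eqP; rewrite eqn_leq !cellI.
  rewrite -jj in ix' *; have windowI (a b : 'I_n) :
      tau a < jump_time (ty j) m x <= tau a.+1 -> tau b < jump_time (ty j) m x <= tau b.+1 ->
      (a <= b)%N.
    move=> /andP[ax _] /andP[_ bx]; rewrite leqNgt; apply/negP => ba.
    have := lt_le_trans ax bx; rewrite ltNge tau_le //; exact: ltnW.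
  by congr pair; apply/val_inj/eqP; rewrite eqn_leq !windowI.
apply/seteqP; split => w /= H.
  move=> [i j] /=; have := H i j.
  rewrite (@typed_count_increment _ (tau i) _ K) ?tauK //; last exact: tauS.
  by move/addnI.
move=> i j; rewrite (@typed_count_increment _ (tau i) _ K) ?tauK //; last exact: tauS.
by congr (_ + _)%N; exact: (H (i, j)).
Qed.

End poisson_processes.

(** * Independence and equality in law of countably valued variables *)
Section discrete_independence.
Context (R : realType) disp (Omega : measurableType disp).
Context (P : probability Omega R) (T : countType).
Implicit Types (X : Omega -> T) (S : set T) (E : set Omega).

Lemma measurable_discrete X S :
  (forall x, measurable [set w | X w = x]) -> measurable [set w | S (X w)].
Proof.
move=> mX; rewrite (_ : [set _ | _] = \bigcup_(n in [set n | exists2 x, S x & pickle x = n])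
  (if pickle_inv n is Some x then [set w | X w = x] else set0)).
  apply: bigcup_measurable => n _; case: pickle_inv => // x; exact: mX.
apply/seteqP; split => w /=.
  by move=> Sw; exists (pickle (X w)); [exists (X w) | rewrite pickleK_inv].
by move=> [_ [x Sx <-]]; rewrite pickleK_inv => ->.
Qed.

Lemma P_discrete X S E :
  (forall x, measurable [set w | X w = x]) -> measurable E ->
  P (E `&` [set w | S (X w)]) = (\sum_(n <oo)
    (if pickle_inv n is Some x then
       if `[< S x >] then P (E `&` [set w | X w = x]) else 0 else 0))%E.
Proof.
move=> mX mE; have mS := measurable_discrete S mX.
have mp n : measurable [set w | pickle (X w) = n].
  exact: (measurable_discrete [set x | pickle x = n]).
rewrite (total_probability_nat P (X := pickle \o X)) //; last exact: measurableI.
apply: eq_eseriesr => n _; case En : (pickle_inv n) => [x|]; last first.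
  rewrite (_ : _ `&` _ = set0) ?measure0 //; apply/seteqP; split => // w [_ /= nw].
  by move: En; rewrite -nw pickleK_inv.
have xn : pickle x = n by have := @pickle_invK T n; rewrite En.
have Xn w : pickle (X w) = n -> X w = x.
  by rewrite -xn => /(pcan_inj pickleK_inv).
case: asboolP => Sx.
  congr (P _); apply/seteqP; split => w /= [].
    by move=> [Ew _] /Xn.
  by move=> Ew Xw; rewrite Xw.
rewrite (_ : _ `&` _ = set0) ?measure0 //; apply/seteqP; split => // w /= [[_ +] /Xn Xw].
by rewrite Xw.
Qed.

(** Independence of an event from a countably valued variable can be tested on
    the values of the variable. *)
Lemma P_discrete_proportional X S E (c : R) : 0 <= c ->
  (forall x, measurable [set w | X w = x]) -> measurable E ->
  (forall x, P (E `&` [set w | X w = x]) = (c%:E * P [set w | X w = x])%E) ->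
  P (E `&` [set w | S (X w)]) = (c%:E * P [set w | S (X w)])%E.
Proof.
move=> c0 mX mE EX; rewrite P_discrete // -[X in (_ * P X)%E]setTI P_discrete //.
rewrite -nneseriesZl; last first.
  by move=> n _; case: pickle_inv => // x; case: ifP.
apply: eq_eseriesr => n _; case: pickle_inv => [x|]; last by rewrite mule0.
by case: ifP; rewrite ?mule0 // EX setTI.
Qed.

Lemma eq_P_discrete X Y S :
  (forall x, measurable [set w | X w = x]) ->
  (forall x, measurable [set w | Y w = x]) ->
  (forall x, P [set w | X w = x] = P [set w | Y w = x]) ->
  P [set w | S (X w)] = P [set w | S (Y w)].
Proof.
move=> mX mY XY; rewrite -[X in P X]setTI -[X in _ = P X]setTI !P_discrete //.
apply: eq_eseriesr => n _; case: pickle_inv => // x; case: ifP => // _.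
by rewrite !setTI.
Qed.

(** The values [x i] are replaced by the sets [S i] one index at a time. *)
Lemma discrete_independence n (X : 'I_n -> Omega -> T) (S : 'I_n -> set T) :
  (forall i x, measurable [set w | X i w = x]) ->
  (forall x : 'I_n -> T, P [set w | forall i, X i w = x i] =
     (\prod_(i < n) P [set w | X i w = x i])%E) ->
  P [set w | forall i, S i (X i w)] = (\prod_(i < n) P [set w | S i (X i w)])%E.
Proof.
move=> mX PX.
suff Q m (U : 'I_n -> set T) :
    (forall i : 'I_n, (m <= i)%N -> exists x, U i = [set x]) ->
    P [set w | forall i, U i (X i w)] = (\prod_(i < n) P [set w | U i (X i w)])%E.
  by apply: (Q n) => i; rewrite leqNgt ltn_ord.
elim: m U => [|m IH] U hU.
  have /choice[x Ux] : forall i, exists x, U i = [set x] by move=> i; exact: hU.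
  rewrite (_ : [set _ | _] = [set w | forall i, X i w = x i]); last first.
    by apply/seteqP; split => w /= H i; have := H i; rewrite Ux.
  rewrite PX; apply: eq_bigr => i _; congr (P _).
  by apply/seteqP; split => w; rewrite /= Ux.
case: (ltnP m n) => [mn|nm]; last first.
  apply: IH => i mi; apply: hU; by have := leq_trans (ltn_ord i) nm; rewrite ltnNge mi.
pose i0 := Ordinal mn.
pose E := [set w | forall i, i != i0 -> U i (X i w)].
have mE : measurable E.
  rewrite (_ : E = \bigcap_(i in [set i | i != i0]) [set w | U i (X i w)]).
    apply: fin_bigcap_measurable => [|i _]; first exact: finite_finset.
    exact: measurable_discrete.
  by apply/seteqP; split => w /= H i; exact: H.
have PE i : P [set w | U i (X i w)] = (fine (P [set w | U i (X i w)]))%:E.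
  by rewrite fineK // fin_num_measure //; exact: measurable_discrete.
pose c := \prod_(i | i != i0) fine (P [set w | U i (X i w)]).
have split_i0 (V : set T) : [set w | forall i, (if i == i0 then V else U i) (X i w)] =
    E `&` [set w | V (X i0 w)].
  apply/seteqP; split => w /=.
    move=> H; split=> [i ii0|]; first by have := H i; rewrite (negbTE ii0).
    by have := H i0; rewrite eqxx.
  by move=> [H Vw] i; case: eqP => [->//|/eqP]; exact: H.
have prodE (V : set T) : (\prod_(i < n) P [set w | (if i == i0 then V else U i) (X i w)] =
    c%:E * P [set w | V (X i0 w)])%E.
  rewrite (bigD1 i0) //= eqxx muleC; congr (_ * _)%E.
  rewrite /c (big_morph EFin (@EFinM R) erefl); apply: eq_bigr => i /negbTE ->; exact: PE.
have -> : [set w | forall i, U i (X i w)] = E `&` [set w | U i0 (X i0 w)].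
  by rewrite -split_i0; apply/seteqP; split => w /= H i; have := H i; case: eqP => // ->.
rewrite (@P_discrete_proportional _ _ _ c) //.
- rewrite -prodE; apply: eq_bigr => i _; congr (P _).
  by apply/seteqP; split => w /=; case: eqP => // ->.
- by apply: prodr_ge0 => i _; rewrite fine_ge0.
- move=> x; rewrite -(prodE [set x]) -(split_i0 [set x]).
  apply: (IH (fun i => if i == i0 then [set x] else U i)) => i mi.
  case: (eqVneq i i0) => [_|ii0]; first by exists x.
  by apply: hU; rewrite ltn_neqAle mi andbT eq_sym.
Qed.

End discrete_independence.

(** * Levy processes with drift and Poisson jumps *)

(** Independent Poisson processes of rate [r].  The paths are step functions, so
    right continuity and left limits take the form of local constancy.  The
    law is stated by additions on [nat], which makes it a statement about
    increments without truncated subtraction. *)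
Record poisson_family (R : realType) disp (Omega : measurableType disp)
    (P : probability Omega R) (r : R) (k : nat)
    (N : 'I_k -> R -> Omega -> nat) : Prop := {
  family_measurable : forall j t, measurable_fun setT (N j t) ;
  family_start : forall j w, N j 0 w = 0%N ;
  family_nondecreasing : forall j s t w, s <= t -> (N j s w <= N j t w)%N ;
  family_right : forall j t w, \forall s \near t^'+, N j s w = N j t w ;
  family_left : forall j t w, exists n, \forall s \near t^'-, N j s w = n ;
  family_law : forall n (tau : nat -> R) (J : finType) (ty : J -> 'I_k)
      (v : 'I_n -> J -> nat), injective ty ->
    0 <= tau 0%N -> (forall i, (i < n)%N -> tau i <= tau i.+1) ->
    P [set w | forall (i : 'I_n) j,
         N (ty j) (tau i.+1) w = (N (ty j) (tau i) w + v i j)%N] =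
    (\prod_(i < n) \prod_j poisson_mass (r * (tau i.+1 - tau i)) (v i j))%:E }.

Section drifted_jumps.
Context (R : realType) disp (Omega : measurableType disp).
Context (P : probability Omega R) (r : R) (k : nat).
Context (N : 'I_k -> R -> Omega -> nat) (hN : poisson_family P r N).

Definition increment (s t : R) (w : Omega) : {ffun 'I_k -> nat} :=
  [ffun j => (N j t w - N j s w)%N].

Lemma measurable_increment s t (v : {ffun 'I_k -> nat}) :
  measurable [set w | increment s t w = v].
Proof.
rewrite (_ : [set _ | _] = [set w | forall j, (N j t w - N j s w)%N = v j]).
  apply: measurable_joint_fiber => j.
  by apply: measurable_fun_subn; exact: family_measurable hN _ _.
apply/seteqP; split => w /=; first by move=> <- j; rewrite ffunE.
by move=> H; apply/ffunP => j; rewrite ffunE.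
Qed.

Lemma incrementP s t w (v : {ffun 'I_k -> nat}) : s <= t ->
  increment s t w = v <-> forall j, N j t w = (N j s w + v j)%N.
Proof.
move=> st; split => [<- j|H]; last by apply/ffunP => j; rewrite ffunE H addKn.
by rewrite ffunE subnKC // (family_nondecreasing hN).
Qed.

Lemma P_increments n (tau : nat -> R) (v : 'I_n -> {ffun 'I_k -> nat}) :
  0 <= tau 0%N -> (forall i, (i < n)%N -> tau i <= tau i.+1) ->
  P [set w | forall i : 'I_n, increment (tau i) (tau i.+1) w = v i] =
  (\prod_(i < n) \prod_j poisson_mass (r * (tau i.+1 - tau i)) (v i j))%:E.
Proof.
move=> tau0 tauS; rewrite -(family_law hN (ty := id)) //; congr (P _).
apply/seteqP; split => w /= H i; last by apply/incrementP => //; exact: tauS.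
by apply/incrementP => //; exact: tauS.
Qed.

Lemma P_increment s t (v : {ffun 'I_k -> nat}) : 0 <= s -> s <= t ->
  P [set w | increment s t w = v] = (\prod_j poisson_mass (r * (t - s)) (v j))%:E.
Proof.
move=> s0 st; have := @P_increments 1 (fun i => if i is 0%N then s else t) (fun=> v).
rewrite big_ord1 /= => <- //; last by case.
by congr (P _); apply/seteqP; split => w /= H; [move=> i; rewrite ord1 | exact: (H ord0)].
Qed.

Context (d : nat) (gam : 'I_d -> R) (B : 'I_d -> 'I_k -> R).

Definition drifted_jumps (t : R) (w : Omega) : 'rV[R]_d :=
  \row_i (gam i * t + \sum_j B i j * (N j t w)%:R).
Local Notation L := drifted_jumps.

Let move_by (h : R) (v : {ffun 'I_k -> nat}) : 'rV[R]_d :=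
  \row_i (gam i * h + \sum_j B i j * (v j)%:R).

(** Increments of [L] are functions of increments of [N]: everything about their
    joint law is transported from the discrete variables [increment]. *)
Let L_increment s t w : s <= t ->
  L t w - L s w = move_by (t - s) (increment s t w).
Proof.
move=> st; apply/rowP => i; rewrite !mxE opprD addrACA -mulrBr; congr (_ + _).
rewrite -sumrB; apply: eq_bigr => j _; rewrite -mulrBr ffunE natrB //.
exact: family_nondecreasing hN _ _ _ _ _.
Qed.

Let L0 w : L 0 w = 0.
Proof.
apply/rowP => i; rewrite !mxE mulr0 add0r big1 // => j _.
by rewrite (family_start hN) mulr0.
Qed.

Lemma random_vector_drifted_jumps t : 0 <= t -> random_vector (L t).
Proof.
move=> t0 A _; rewrite (_ : _ @^-1` _ =
    [set w | (move_by t @^-1` A) (increment 0 t w)]).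
  exact/measurable_discrete/measurable_increment.
by apply/seteqP; split => w /=; rewrite -[X in move_by X _]subr0 -L_increment // L0 subr0.
Qed.

Lemma independent_increments_drifted_jumps n (t : nat -> R) :
  0 <= t 0%N -> (forall i, (i < n)%N -> t i < t i.+1) ->
  mutually_independent P (fun (i : 'I_n) w => L (t i.+1) w - L (t i) w).
Proof.
move=> t0 tS A _.
have tS' i : (i < n)%N -> t i <= t i.+1 by move=> /tS/ltW.
have t_ge0 i : (i <= n)%N -> 0 <= t i.
  by elim: i => [//|i IH] i_n; rewrite (le_trans (IH (ltnW i_n))) // tS'.
have SE i w : A i (L (t i.+1) w - L (t i) w) <->
    (move_by (t i.+1 - t i) @^-1` A i) (increment (t i) (t i.+1) w).
  by rewrite L_increment ?tS'.
transitivity (P [set w | forall i : 'I_n, (move_by (t i.+1 - t i) @^-1` A i)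
    (increment (t i) (t i.+1) w)]).
  by congr (P _); apply/seteqP; split => w /= H i; apply/SE.
rewrite (@discrete_independence _ _ _ P _ n
  (fun i => increment (t i) (t i.+1)) (fun i => move_by (t i.+1 - t i) @^-1` A i)).
- by apply: eq_bigr => i _; congr (P _); apply/seteqP; split => w /= /SE.
- by move=> i x; exact: measurable_increment.
- move=> x; rewrite P_increments // (big_morph EFin (@EFinM R) erefl).
  apply: eq_bigr => i _; rewrite P_increment ?tS' //.
  by rewrite t_ge0 // ltnW.
Qed.

Lemma stationary_increments_drifted_jumps (s h : R) :
  0 <= s -> 0 <= h ->
  forall A, P [set w | A (L (s + h) w - L s w)] = P [set w | A (L h w - L 0 w)].
Proof.
move=> s0 h0 A; have sh : s <= s + h by rewrite lerDl.
transitivity (P [set w | (move_by h @^-1` A) (increment s (s + h) w)]).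
  by congr (P _); apply/seteqP; split => w /=; rewrite L_increment // addrAC subrr add0r.
transitivity (P [set w | (move_by h @^-1` A) (increment 0 h w)]); last first.
  by congr (P _); apply/seteqP; split => w /=; rewrite L_increment // subr0.
apply: eq_P_discrete => [v|v|v]; [exact: measurable_increment..|].
by rewrite !P_increment // subr0 addrAC subrr add0r.
Qed.

(** On each side of [t] the vector [N] is locally constant, so [L] coincides
    there with an affine function of time. *)
Lemma cadlag_drifted_jumps w t :
  L s w @[s --> t^'+] --> L t w /\ cvg (L s w @[s --> t^'-]).
Proof.
pose h (n : 'I_k -> nat) (s : R) : 'rV[R]_d :=
  s *: (\row_i gam i) + \row_i \sum_j B i j * (n j)%:R.
have hE n s : (forall j, N j s w = n j) -> L s w = h n s.
  move=> Nn; apply/rowP => i; rewrite !mxE mulrC; congr (_ + _).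
  by apply: eq_bigr => j _; rewrite Nn.
have ch n : {for t, continuous (h n)}.
  by apply: cvgD; [apply: cvgZr_tmp; exact: cvg_id | exact: cvg_cst].
split.
  have nt : \forall s \near t^'+, h (fun j => N j t w) s = L s w.
    have H : \forall s \near t^'+, forall j, N j s w = N j t w.
      by apply: filter_forall => j; exact: family_right hN _ _ _.
    by apply: filterS H => s Hs; rewrite (hE (fun j => N j t w)).
  apply: cvg_trans; first exact: (near_eq_cvg (F := t^'+) nt).
  rewrite (hE (fun j => N j t w)) //; apply: cvg_at_right_filter; exact: ch.
have /choice[n hn] := fun j => family_left hN j t w.
have nt : \forall s \near t^'-, h n s = L s w.
  have H : \forall s \near t^'-, forall j, N j s w = n j.
    by apply: filter_forall => j; exact: hn.
  by apply: filterS H => s Hs; rewrite (hE n).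
apply/cvg_ex; exists (h n t); apply: cvg_trans; first exact: (near_eq_cvg (F := t^'-) nt).
apply: cvg_at_left_filter; exact: ch.
Qed.

(** For [s] close to [t] the drift alone moves [L] by at most [e]; a larger
    increment forces some jump between [s] and [t], an event of probability
    [1 - expR (- (r * `|s - t|)) ^+ k]. *)
Lemma stochastic_continuity_drifted_jumps (t e : R) : 0 <= t -> 0 < e ->
  P [set w | e < `|L s w - L t w|]
    @[s --> within [set s | 0 <= s] (nbhs t)] --> 0%E.
Proof.
move=> t0 e0.
pose G := \sum_i `|gam i|.
have G0 : 0 <= G by apply: sumr_ge0.
pose bound s : R := 1 - expR (- (r * `|s - t|)) ^+ k.
have near_t : \forall s \near nbhs t, G * `|s - t| <= e.
  have e1 : 0 < e / (G + 1) by rewrite divr_gt0 // ltr_wpDl.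
  near=> s.
  have : `|s - t| < e / (G + 1).
    rewrite distrC; near: s; exact: (@cvgr_dist_lt _ _ _ (nbhs t) _ id t (@cvg_id _ _)).
  rewrite ltr_pdivlMr ?ltr_wpDl // => /ltW; apply: le_trans.
  by rewrite mulrC ler_wpM2l // lerDl.
apply: (@squeeze_cvge _ _ _ _ (cst 0%E) _ (fun s => (bound s)%:E)).
- apply: filterS near_t => s ste s0; rewrite measure_ge0 /=.
  pose lo := Num.min s t; pose hi := Num.max s t.
  have lohi : lo <= hi by rewrite ge_min le_max lexx.
  have lo0 : 0 <= lo by rewrite le_min s0.
  have hilo : hi - lo = `|s - t|.
    rewrite /hi /lo; case: (leP s t) => st; last by rewrite gtr0_norm ?subr_gt0.
    by rewrite distrC ger0_norm ?subr_ge0.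
  have normE w : `|L s w - L t w| = `|move_by (hi - lo) (increment lo hi w)|.
    rewrite -L_increment // /hi /lo; case: (leP s t) => // _; exact: distrC.
  have -> : [set w | e < `|L s w - L t w|] =
      [set w | [set v | e < `|move_by (hi - lo) v|] (increment lo hi w)].
    by apply/seteqP; split => w /=; rewrite normE.
  pose Z : {ffun 'I_k -> nat} := [ffun=> 0%N].
  have -> : (bound s)%:E = P (~` [set w | increment lo hi w = Z]).
    rewrite probability_setC; last exact: measurable_increment.
    rewrite P_increment // hilo EFinB; congr (_ - _%:E)%E.
    rewrite -[X in _ ^+ X](card_ord k) -prodr_const; apply: eq_bigr => j _.
    by rewrite ffunE /poisson_mass expr0 fact0 divr1 mul1r.
  apply: le_measure; rewrite ?inE.
  - exact/measurable_discrete/measurable_increment.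
  - exact/measurableC/measurable_increment.
  - move=> w /= + wZ; rewrite wZ hilo ltNge => /negP; apply.
    rewrite /Num.norm /= mx_normrE; apply: bigmax_le; first exact: ltW.
    move=> [i j] _ /=; rewrite mxE big1 ?addr0; last first.
      by move=> l _; rewrite ffunE mulr0.
    rewrite normrM normr_id; apply: le_trans ste; rewrite ler_wpM2r //.
    by rewrite /G (bigD1 j) //= lerDl sumr_ge0.
- exact: cvg_cst.
- apply: cvg_within_filter; apply: cvg_EFin; first exact: nearW.
  have -> : 0 = bound t.
    by rewrite /bound subrr normr0 mulr0 oppr0 expR0 expr1n subrr.
  rewrite (_ : fine \o _ = bound) //.
  apply: cvgB; first exact: cvg_cst.
  apply: (@continuous_cvg _ _ _ (nbhs t) _ (fun s => expR (- (r * `|s - t|)))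
    (fun y => y ^+ k)); first exact: exprn_continuous.
  apply: (@continuous_cvg _ _ _ (nbhs t) _ (fun s => - (r * `|s - t|)) expR).
    exact: continuous_expR.
  apply: cvgN; apply: cvgMl_tmp; apply: cvg_norm; apply: cvgB; last exact: cvg_cst.
  exact: cvg_id.
Unshelve. all: by end_near. Qed.

Lemma levy_process_drifted_jumps : levy_process P L.
Proof.
split.
- exact: random_vector_drifted_jumps.
- by apply: aeW => w; exact: L0.
- exact: independent_increments_drifted_jumps.
- by move=> s h s0 h0 A _; exact: stationary_increments_drifted_jumps.
- exact: stochastic_continuity_drifted_jumps.
- by apply: aeW => w t t0; have [] := cadlag_drifted_jumps w t; split.
Qed.

Lemma nondecreasing_drifted_jumps i s t w :
  0 <= gam i -> (forall j, 0 <= B i j) -> s <= t ->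
  L s w ord0 i <= L t w ord0 i.
Proof.
move=> gam0 B0 st; rewrite !mxE lerD ?ler_wpM2l // ler_sum // => j _.
by rewrite ler_wpM2l // ler_nat (family_nondecreasing hN).
Qed.

End drifted_jumps.

(** * Moments *)
Section poisson_moments.
Context (R : realType).
Implicit Types (r : R).

Lemma nneseries_shift (h : nat -> \bar R) : (forall n, 0 <= h n)%E ->
  (\sum_(n <oo) (if n is m.+1 then h m else 0) = \sum_(n <oo) h n)%E.
Proof.
move=> h0; rewrite nneseries_recl; [|by case|by []].
rewrite add0e -(nneseries_addn 1); last by case.
by apply: eq_eseriesr => n _; rewrite addn1.
Qed.

Lemma poisson_first_moment r : 0 <= r ->
  (\sum_(n <oo) (n%:R * poisson_mass r n)%:E = r%:E)%E.
Proof.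
move=> r0; transitivity (r%:E * \sum_(n <oo) (if n is m.+1 then (poisson_mass r m)%:E else 0))%E.
  rewrite -nneseriesZl; last by case=> // n _; rewrite lee_fin poisson_mass_ge0.
  by apply: eq_eseriesr => n _; rewrite poisson_mass_shift EFinM; case: n.
by rewrite nneseries_shift ?poisson_mass_series ?mule1 // => n; rewrite lee_fin poisson_mass_ge0.
Qed.

Lemma poisson_second_moment r : 0 <= r ->
  (\sum_(n <oo) (n%:R ^+ 2 * poisson_mass r n)%:E = (r ^+ 2 + r)%:E)%E.
Proof.
move=> r0; pose h n := ((n%:R * poisson_mass r n)%:E + (poisson_mass r n)%:E)%E.
have h0 n : (0 <= h n)%E.
  by rewrite /h -EFinD lee_fin addr_ge0 ?poisson_mass_ge0 // mulr_ge0 ?poisson_mass_ge0.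
transitivity (r%:E * \sum_(n <oo) (if n is m.+1 then h m else 0))%E.
  rewrite -nneseriesZl; last by case.
  apply: eq_eseriesr => n _; rewrite expr2 -mulrA poisson_mass_shift.
  case: n => [|n]; first by rewrite mulr0 mulr0 mule0.
  rewrite /h -EFinD -EFinM; congr EFin; rewrite -natr1; ring.
rewrite nneseries_shift // nneseriesD //.
- by rewrite poisson_first_moment // poisson_mass_series // -EFinD -EFinM; congr EFin; ring.
- by move=> n _; rewrite lee_fin mulr_ge0 ?poisson_mass_ge0.
- by move=> n _; rewrite lee_fin poisson_mass_ge0.
Qed.

End poisson_moments.

Section expectation_calculus.
Context (R : realType) disp (Omega : measurableType disp).
Context (P : probability Omega R).
Implicit Types (f g : Omega -> R) (m c : R).

(** Integrability is part of the predicate, so that linearity holds without side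
    conditions. *)
Definition has_expectation f m := f \in Lfun P 1 /\ ('E_P[f] = m%:E)%E.

Lemma has_expectation_cst c : has_expectation (fun=> c) c.
Proof. by split; [exact: (Lfun_cst P c 1) | exact: expectation_cst]. Qed.

Lemma has_expectationD f g m m' : has_expectation f m -> has_expectation g m' ->
  has_expectation (fun w => f w + g w) (m + m').
Proof.
move=> [f1 fm] [g1 gm]; split; first exact: (rpredD f1 g1).
by rewrite (expectationD f1 g1) fm gm.
Qed.

Lemma has_expectationZ c f m : has_expectation f m ->
  has_expectation (fun w => c * f w) (c * m).
Proof.
move=> [f1 fm]; rewrite (_ : (fun w => _) = c \o* f); last first.
  by apply/funext => w /=; rewrite mulrC.
split; last by rewrite expectationZl // fm EFinM.
rewrite (_ : c \o* f = c *: f) ?rpredZ //.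
by apply/funext => w /=; rewrite mulrC.
Qed.

Lemma has_expectation_sum (I : Type) (s : seq I) (f : I -> Omega -> R)
    (m : I -> R) :
  (forall i, has_expectation (f i) (m i)) ->
  has_expectation (fun w => \sum_(i <- s) f i w) (\sum_(i <- s) m i).
Proof.
move=> fm; elim: s => [|i s IH].
  rewrite big_nil; under eq_fun do rewrite big_nil; exact: has_expectation_cst.
rewrite big_cons; under eq_fun do rewrite big_cons; exact: has_expectationD.
Qed.

Lemma has_expectation_ge0 f m : measurable_fun setT f -> (forall w, 0 <= f w) ->
  (\int[P]_w (f w)%:E = m%:E)%E -> has_expectation f m.
Proof.
move=> mf f0 fm; split; last by rewrite unlock.
apply/Lfun1_integrable/integrableP; split; first exact/measurable_EFinP.
rewrite (_ : (\int[P]_w _ = m%:E)%E) ?ltry // -fm.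
by apply: eq_integral => w _ /=; rewrite ger0_norm.
Qed.

Lemma ge0_integral_by_value (X : Omega -> nat) (g : Omega -> \bar R) E :
  measurable_fun setT X -> measurable E -> measurable_fun setT g ->
  (forall w, 0 <= g w)%E ->
  (\int[P]_(w in E) g w =
   \sum_(n <oo) \int[P]_(w in E `&` [set w | X w = n]) g w)%E.
Proof.
move=> mX mE mg g0; rewrite -ge0_integral_bigcup //.
- by congr integral; apply/seteqP; split => w; [move=> Ew; exists (X w)|case=> n _ []].
- by move=> n; apply: measurableI => //; exact: measurable_fiber.
- exact: measurable_funTS.
- by move=> i j _ _ [w [[_ /= <-] [_ /= <-]]].
Qed.

Lemma integral_nat_function (X : Omega -> nat) (f : nat -> R) E :
  measurable_fun setT X -> measurable E -> (forall n, 0 <= f n) ->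
  (\int[P]_(w in E) (f (X w))%:E =
   \sum_(n <oo) (f n)%:E * P (E `&` [set w | X w = n]))%E.
Proof.
move=> mX mE f0; rewrite (ge0_integral_by_value mX) //.
- apply: eq_eseriesr => n _; have mEn := measurableI _ _ mE (measurable_fiber n mX).
  rewrite -integral_cst //; apply: eq_integral => w; rewrite inE => -[_ /= ->] //.
- by apply/measurable_EFinP; exact: (measurableT_comp (f := f) _ mX).
- by move=> w; rewrite lee_fin.
Qed.

Lemma integral_nat_function2 (X Y : Omega -> nat) (f g : nat -> R) :
  measurable_fun setT X -> measurable_fun setT Y ->
  (forall n, 0 <= f n) -> (forall n, 0 <= g n) ->
  (\int[P]_w (f (X w) * g (Y w))%:E = \sum_(a <oo) \sum_(b <oo)
     (f a * g b)%:E * P ([set w | X w = a] `&` [set w | Y w = b]))%E.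
Proof.
move=> mX mY f0 g0; rewrite (ge0_integral_by_value mX) //.
- apply: eq_eseriesr => a _; rewrite setTI.
  rewrite -(integral_nat_function (f := fun b => f a * g b) mY) //.
  + by apply: eq_integral => w; rewrite inE /= => ->.
  + exact: measurable_fiber.
  + by move=> n; rewrite mulr_ge0.
- apply/measurable_EFinP; apply: measurable_funM.
    exact: (measurableT_comp (f := f) _ mX).
  exact: (measurableT_comp (f := g) _ mY).
- by move=> w; rewrite lee_fin mulr_ge0.
Qed.

End expectation_calculus.

Section moments.
Context (R : realType) disp (Omega : measurableType disp).
Context (P : probability Omega R) (r : R) (r0 : 0 <= r) (k : nat).
Context (N : 'I_k -> R -> Omega -> nat) (hN : poisson_family P r N).

(** The law of the increments over [[0, 1]]. *)
Let P_joint (J : finType) (ty : J -> 'I_k) (v : J -> nat) : injective ty ->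
  P [set w | forall j, N (ty j) 1 w = v j] = (\prod_j poisson_mass r (v j))%:E.
Proof.
move=> ty_inj.
have := family_law hN (n := 1) (tau := fun i => i%:R) (fun=> v) ty_inj (lexx 0).
rewrite big_ord1 subr0 mulr1 => <- => [|i _]; last by rewrite ler_nat.
congr (P _); apply/seteqP; split => w /= H.
  by move=> i j; rewrite ord1 (family_start hN); exact: H.
by move=> j; have := H ord0 j; rewrite (family_start hN).
Qed.

Let mN j : measurable_fun setT (N j 1).
Proof. exact: family_measurable hN _ _. Qed.

Let P_value j n : P [set w | N j 1 w = n] = (poisson_mass r n)%:E.
Proof.
have := @P_joint unit (fun=> j) (fun=> n); rewrite big_const card_unit /= mulr1.
move=> <-; last by case=> -[].
by congr (P _); apply/seteqP; split => w /= H; [move=> _ | exact: (H tt)].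
Qed.

Let P_values j l a b : j != l ->
  P ([set w | N j 1 w = a] `&` [set w | N l 1 w = b]) = (poisson_mass r a * poisson_mass r b)%:E.
Proof.
move=> jl; have := @P_joint bool (fun c => if c then j else l) (fun c => if c then a else b).
rewrite big_bool /= => <-.
  congr (P _); apply/seteqP; split => w /=; first by move=> [Ha Hb] [].
  by move=> H; split; [exact: (H true) | exact: (H false)].
by move=> [] [] // E; rewrite E eqxx in jl.
Qed.

Lemma has_expectation_poisson j : has_expectation P (fun w => (N j 1 w)%:R) r.
Proof.
apply: has_expectation_ge0 => //.
  exact: (measurableT_comp (f := fun n => n%:R : R) _ (mN j)).
rewrite (integral_nat_function _ (f := fun n => n%:R) (mN j)) //.
rewrite -(poisson_first_moment r0); apply: eq_eseriesr => n _.
by rewrite setTI P_value -EFinM.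
Qed.

Lemma has_expectation_poisson_mul j l :
  has_expectation P (fun w => (N j 1 w)%:R * (N l 1 w)%:R)
    (r ^+ 2 + (if j == l then r else 0)).
Proof.
apply: has_expectation_ge0 => [|w|]; last 1 first.
- case: eqVneq => [<-|jl].
    under eq_integral do rewrite -expr2.
    rewrite (integral_nat_function _ (f := fun n => n%:R ^+ 2) (mN j)) //.
    rewrite -(poisson_second_moment r0); apply: eq_eseriesr => n _.
    by rewrite setTI P_value -EFinM.
  rewrite (integral_nat_function2 _ (f := fun n => n%:R) (g := fun n => n%:R)
    (mN j) (mN l)) //.
  transitivity (\sum_(a <oo) (r%:E * (a%:R * poisson_mass r a)%:E))%E.
    apply: eq_eseriesr => a _; rewrite muleC -(poisson_first_moment r0).
    rewrite -nneseriesZl => [|n _]; last by rewrite lee_fin mulr_ge0 ?poisson_mass_ge0.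
    by apply: eq_eseriesr => b _; rewrite P_values // -!EFinM; congr EFin; ring.
  rewrite nneseriesZl => [|n _]; last by rewrite lee_fin mulr_ge0 ?poisson_mass_ge0.
  by rewrite poisson_first_moment // -EFinM addr0.
- by apply: measurable_funM;
    [exact: (measurableT_comp (f := fun n => n%:R : R) _ (mN j)) |
     exact: (measurableT_comp (f := fun n => n%:R : R) _ (mN l))].
- by rewrite mulr_ge0.
Qed.

Context (d : nat) (gam : 'I_d -> R) (B : 'I_d -> 'I_k -> R).
Local Notation L := (drifted_jumps N gam B).

Let mean i := gam i + \sum_j B i j * r.

Lemma has_expectation_drifted_jumps i :
  has_expectation P (fun w => L 1 w ord0 i) (mean i).
Proof.
rewrite (_ : (fun w => _) = fun w => gam i + \sum_j B i j * (N j 1 w)%:R); last first.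
  by apply/funext => w; rewrite mxE mulr1.
apply: has_expectationD; first exact: has_expectation_cst.
by apply: has_expectation_sum => j; apply: has_expectationZ; exact: has_expectation_poisson.
Qed.

(** The centered variables [N j 1 - r] are orthogonal with variance [r]; the
    covariance is the expectation of a product of two of their linear
    combinations. *)
Lemma covariance_drifted_jumps i l :
  covariance P (fun w => L 1 w ord0 i) (fun w => L 1 w ord0 l) =
  (r * \sum_j B i j * B l j)%:E.
Proof.
have [_ Ei] := has_expectation_drifted_jumps i; have [_ El] := has_expectation_drifted_jumps l.
rewrite unlock Ei El /=.
pose c j m w : R := ((N j 1 w)%:R - r) * ((N m 1 w)%:R - r).
have hc j m : has_expectation P (c j m) (if j == m then r else 0).
  rewrite (_ : c j m = fun w => (N j 1 w)%:R * (N m 1 w)%:R +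
      ((- r) * (N j 1 w)%:R + ((- r) * (N m 1 w)%:R + r ^+ 2))); last first.
    by apply/funext => w; rewrite /c; ring.
  rewrite [X in has_expectation _ _ X](_ : _ = (r ^+ 2 + (if j == m then r else 0)) +
      ((- r) * r + ((- r) * r + r ^+ 2))); last by ring.
  apply: has_expectationD; first exact: has_expectation_poisson_mul.
  apply: has_expectationD; first exact/has_expectationZ/has_expectation_poisson.
  apply: has_expectationD; last exact: has_expectation_cst.
  exact/has_expectationZ/has_expectation_poisson.
have [_] : has_expectation P (fun w => \sum_j \sum_m B i j * B l m * c j m w)
    (\sum_j \sum_m B i j * B l m * (if j == m then r else 0)).
  apply: has_expectation_sum => j; apply: has_expectation_sum => m.
  exact: has_expectationZ.
rewrite (_ : \sum_j _ = r * \sum_j B i j * B l j) => [<-|]; last first.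
  rewrite mulr_sumr; apply: eq_bigr => j _; rewrite (bigD1 j) //= eqxx big1 ?addr0.
    by rewrite mulrC.
  by move=> m /negbTE; rewrite eq_sym => ->; rewrite mulr0.
congr expectation; apply/funext => w /=.
transitivity ((L 1 w ord0 i - mean i) * (L 1 w ord0 l - mean l)); first by [].
rewrite !mxE !mulr1.
have centered a : gam a + \sum_j B a j * (N j 1 w)%:R - mean a =
    \sum_j B a j * ((N j 1 w)%:R - r).
  rewrite /mean opprD addrACA subrr add0r -sumrB.
  by apply: eq_bigr => j _; rewrite mulrBr.
rewrite !centered mulr_suml; apply: eq_bigr => j _.
by rewrite mulr_sumr; apply: eq_bigr => m _; rewrite /c; ring.
Qed.

End moments.

(** * Existence of the subordinator *)

(** A coordinate of [drifted_jumps N gam B] is the one-dimensional process with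
    the corresponding row of [B]. *)
Lemma multivariate_subordinator_drifted_jumps (R : realType) disp
    (Omega : measurableType disp) (P : probability Omega R) (r : R) (k : nat)
    (N : 'I_k -> R -> Omega -> nat) (d : nat)
    (gam : 'I_d -> R) (B : 'I_d -> 'I_k -> R) :
  0 <= r -> poisson_family P r N ->
  (forall i, 0 <= gam i) -> (forall i j, 0 <= B i j) ->
  multivariate_subordinator P (drifted_jumps N gam B).
Proof.
move=> r0 hN gam0 B0; split; first exact: (levy_process_drifted_jumps hN).
move=> i; split; last first.
  by apply: aeW => w s t _ st; exact: (nondecreasing_drifted_jumps hN).
rewrite (_ : (fun t w => _) =
    drifted_jumps N (fun _ : 'I_1 => gam i) (fun _ => B i)).
  exact: (levy_process_drifted_jumps hN).
by apply/funext => t; apply/funext => w; apply/rowP => j; rewrite !mxE.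
Qed.

Lemma exists_poisson_family (R : realType) (r : R) (k : nat) : 0 <= r ->
  exists (disp : measure_display) (Omega : measurableType disp)
    (P : probability Omega R) (N : 'I_k -> R -> Omega -> nat),
    poisson_family P r N.
Proof.
move=> r0.
have src := splitting_source_coins R.
pose lam : R := r * k.+1%:R.
have lam0 : 0 <= lam by rewrite mulr_ge0.
exists _, coin_space, (coin_measure R),
  (fun j => typed_count evens odds (@dyadic_value R) lam k j); split.
- by move=> j t; exact: (measurable_typed_count src lam0).
- by move=> j w; exact: typed_count0.
- by move=> j s t w; exact: typed_count_nondecreasing.
- by move=> j t w; exact: typed_count_right.
- by move=> j t w; exact: typed_count_left.
- move=> n tau J ty v ty_inj tau0 tauS.
  have lamE : lam / k.+1%:R = r by rewrite mulfK.
  rewrite -lamE -(P_typed_increments src lam0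
    (ty := fun j => ty j : nat)) //.
    by move=> i j /val_inj /ty_inj.
  by move=> j; rewrite -ltnS ltnW // ltnS.
Qed.

Theorem proposition5p3 (R : realType) (d : nat) (C : 'M[R]_d) (mu : 'rV[R]_d)
    (hC : completely_positive C) (hmu : forall i, 0 < mu ord0 i) :
  exists (disp : measure_display) (Omega : measurableType disp)
    (P : probability Omega R) (L : R -> Omega -> 'rV[R]_d),
    [/\ multivariate_subordinator P L,
        has_mean P (L 1) mu
      & has_covariance_matrix P (L 1) C].
Proof.
have [k [B [B0 ->]]] := hC.
pose b i := \sum_j B i j.
have b0 i : 0 <= b i by apply: sumr_ge0.
(* Large enough for each mean [b i / a] of the jump part to be at most mu. *)
pose a : R := 1 + \sum_i b i / mu ord0 i.
have a0 : 0 < a.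
  by rewrite ltr_pwDl // sumr_ge0 // => i _; rewrite divr_ge0 // ltW.
have ab i : b i / a <= mu ord0 i.
  rewrite ler_pdivrMr // mulrC -ler_pdivrMr //.
  rewrite /a (bigD1 i) //= addrCA lerDl addr_ge0 // sumr_ge0 // => j _.
  by rewrite divr_ge0 // ltW.
pose r := a ^- 2.
have r0 : 0 <= r by rewrite invr_ge0 exprn_ge0 // ltW.
have [disp [T [P [N hN]]]] := exists_poisson_family k r0.
pose gam i := mu ord0 i - b i / a.
exists disp, T, P, (drifted_jumps N gam (fun i j => a * B i j)); split.
- apply: (multivariate_subordinator_drifted_jumps r0 hN) => [i|i j].
    by rewrite subr_ge0.
  by rewrite mulr_ge0 // ltW.
- move=> i; have [_ ->] := has_expectation_drifted_jumps r0 hN gam (fun i j => a * B i j) i.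
  congr EFin; rewrite -mulr_suml -mulr_sumr -/(b i) /gam /r; field.
  by rewrite gt_eqF.
- move=> i l; rewrite (covariance_drifted_jumps r0 hN) mxE; congr EFin.
  rewrite mulr_sumr; apply: eq_bigr => j _; rewrite mxE /r; field.
  by rewrite gt_eqF.
Qed.
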